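(* Let $X$ be a manifold with an almost $s$-Kähler structure of rank two, $s\ge 2$. For a fixed $p\in X$, the orthogonal algebra $\mathit{Lef}^s_p\cong\mathbf{so}(s+1,s+1)$ coincides with the intersection $\mathcal{L}^s_{\mathbb{R},p}\cap\mathbf{s}\mathcal{L}^s_p$.
   Context: Fix $s\ge 2$. An almost $s$-Kähler structure of rank two on a smooth manifold $X$ of dimension $2(s+1)$ consists of a Riemannian metric $\mathbf{g}$ and smooth two-forms $\omega_{jk}$, $j,k\in\{0,\dots,s\}$, such that: (i) $\omega_{01},\dots,\omega_{0s}$ are closed and around every point there are coordinates $x_1,x_2,y^j_1,y^j_2$ ($1\le j\le s$) with $\omega_{0j}=\sum_{i=1}^2 dx_i\wedge dy^j_i$ for all $j$; (ii) at every $p\in X$ there is an orthonormal basis $\{v_{ij}: i=1,2,\ j=0,\dots,s\}$ of $T^*_pX$ (an adapted coframe) with $\omega_{jk}=\sum_{i=1}^2 v_{ij}\wedge v_{ik}$ at $p$ for all $j,k$. Any two adapted coframes at $p$ are related by $v'_{ij}=\sum_l a_{il}v_{lj}$ with $(a_{il})\in \mathbf{O}(2)$; so the spaces $W_j=\langle v_{1j},v_{2j}\rangle$ are canonical. On $\bigwedge^*_{\mathbb{C}}T^*_pX$ let $E_{ij}$ be the wedge product with $v_{ij}$; $*$ denotes the adjoint with respect to the Hermitian metric induced by $\mathbf{g}$. Put, for $j\neq k$, $L_{jk}=\sum_{i=1}^2E_{ij}E_{ik}$ (wedge with $\omega_{jk}$), $V_j=E_{1j}E_{2j}$ (wedge with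 the volume form of $W_j$, defined up to a sign common to all $j$ which is fixed by choosing an orientation of $W_0$), $\Lambda_{jk}=L_{jk}^*$, $A_j=V_j^*$. The following are real Lie algebras (commutator bracket) of operators on $\bigwedge^*_{\mathbb{C}}T_p^*X$, generated over $\mathbb{R}$: $\mathit{Lef}^s_p$ by all $L_{jk},\Lambda_{jk}$; $\mathcal{L}^s_{\mathbb{R},p}$ by all $L_{jk},V_j,\Lambda_{jk},A_j$; $\mathbf{s}\mathcal{L}^s_p$ by all $L_{jk},\sqrt{-1}V_j,\Lambda_{jk},\sqrt{-1}A_j$. *)

(* Defs.v *)
From HB Require Import structures.
From mathcomp Require Import all_boot all_order all_algebra.
From mathcomp Require Import all_classical all_reals all_analysis.
From mathcomp Require Import complex.

Set Implicit Arguments.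
Unset Strict Implicit.
Unset Printing Implicit Defensive.

Import Order.TTheory GRing.Theory Num.Theory.
Import numFieldNormedType.Exports.

Local Open Scope classical_set_scope.
Local Open Scope ring_scope.
Local Open Scope complex_scope.

Definition partial (R : realType) (n : nat) (i : 'I_n) (f : 'rV[R]_n -> R) :
    'rV[R]_n -> R :=
  'D_(delta_mx 0 i) f.

(* On an open set, having all iterated partial derivatives (including f itself)
   differentiable is being C^oo. *)
Definition smooth_on (R : realType) (n : nat) (U : set 'rV[R]_n)
    (f : 'rV[R]_n -> R) : Prop :=
  forall (l : seq 'I_n) (y : 'rV[R]_n), U y ->
    differentiable (foldr (@partial R n) f l) y.

(* A homeomorphism from an open set of X onto an open set of R^n; the values of
   [coord] outside [dom] and of [param] outside [cod] are irrelevant. *)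
Record chart (R : realType) (n : nat) (X : topologicalType) := Chart {
  dom : set X;
  cod : set 'rV[R]_n;
  coord : X -> 'rV[R]_n;
  param : 'rV[R]_n -> X;
  open_dom : open dom;
  open_cod : open cod;
  coord_cod : forall x, dom x -> cod (coord x);
  param_dom : forall y, cod y -> dom (param y);
  coordK : forall x, dom x -> param (coord x) = x;
  paramK : forall y, cod y -> coord (param y) = y;
  coord_continuous : {within dom, continuous coord};
  param_continuous : {within cod, continuous param}
}.

Definition transition (R : realType) (n : nat) (X : topologicalType)
    (c c' : chart R n X) : 'rV[R]_n -> 'rV[R]_n :=
  fun y => coord c' (param c y).

Definition smooth_transition (R : realType) (n : nat) (X : topologicalType)
    (c c' : chart R n X) : Prop :=
  forall a : 'I_n, smooth_on (cod c `&` param c @^-1` dom c')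
    (fun y => transition c c' y 0 a).

Definition compatible (R : realType) (n : nat) (X : topologicalType)
    (c c' : chart R n X) : Prop :=
  smooth_transition c c' /\ smooth_transition c' c.

Record manifold (R : realType) (n : nat) := Manifold {
  carrier :> topologicalType;
  atlas : set (chart R n carrier);
  manifold_hausdorff : hausdorff_space carrier;
  manifold_second_countable : @second_countable carrier;
  atlas_cover : forall p : carrier, exists2 c, atlas c & dom c p;
  atlas_compatible : forall c c', atlas c -> atlas c' -> compatible c c';
  atlas_maximal : forall c, (forall c', atlas c' -> compatible c c') -> atlas c
}.

(* Tensor fields, given by their components in the charts of the atlas:
   [T c p a b] is T(d/dx_a, d/dx_b) at p, for the coordinates x of the chart c.
   The components of tangent vectors, v = \sum_a v_a d/dx_a, and of covectors,
   w = \sum_a w_a dx_a, are row vectors. *)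

Definition components (R : realType) (n : nat) (X : manifold R n) :=
  chart R n X -> X -> 'M[R]_n.

Definition component (R : realType) (n : nat) (X : manifold R n)
    (T : components X) (c : chart R n X) (a b : 'I_n) : 'rV[R]_n -> R :=
  fun y => T c (param c y) a b.

(* [jacobian] acts on row vectors on the right, so tangent vectors transform by
   v' = v *m J, and T (v, w) = v *m T *m w^T. *)
Definition tensor2 (R : realType) (n : nat) (X : manifold R n)
    (T : components X) : Prop :=
  (forall c c' p, atlas c -> atlas c' -> dom c p -> dom c' p ->
     let J := jacobian (transition c c') (coord c p) in
     T c p = J *m T c' p *m J^T) /\
  (forall c a b, atlas c -> smooth_on (cod c) (component T c a b)).

Definition riemannian_metric (R : realType) (n : nat) (X : manifold R n)
    (g : components X) : Prop :=
  tensor2 g /\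
  forall c p, atlas c -> dom c p ->
    (g c p)^T = g c p /\
    forall v : 'rV[R]_n, v != 0 -> 0 < (v *m g c p *m v^T) 0 0.

Definition two_form (R : realType) (n : nat) (X : manifold R n)
    (w : components X) : Prop :=
  tensor2 w /\ forall c p, atlas c -> dom c p -> (w c p)^T = - w c p.

Definition closed_form (R : realType) (n : nat) (X : manifold R n)
    (w : components X) : Prop :=
  forall c, atlas c -> forall y, cod c y -> forall a b d : 'I_n,
    partial a (component w c b d) y - partial b (component w c a d) y
    + partial d (component w c a b) y = 0.

(* Components of the 2-form v /\ w at a point. *)
Definition wedge1 (R : realType) (n : nat) (v w : 'rV[R]_n) : 'M[R]_n :=
  v^T *m w - w^T *m v.

(* [invmx G] is the Gram matrix of the dx_a for the metric induced on covectors
   by the metric with components G. *)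
Definition cometric (R : realType) (n : nat) (G : 'M[R]_n) (v w : 'rV[R]_n) : R :=
  (v *m invmx G *m w^T) 0 0.

Definition orthonormal_coframe (R : realType) (s n : nat) (G : 'M[R]_n)
    (v : 'I_2 -> 'I_s.+1 -> 'rV[R]_n) : Prop :=
  forall i j k l, cometric G (v i j) (v k l) = ((i == k) && (j == l))%:R.

Definition coord_index (s : nat) (i : 'I_2) (j : 'I_s.+1) : 'I_(2 * s.+1) :=
  mxvec_index i j.

Definition dcoord (R : realType) (s : nat) (i : 'I_2) (j : 'I_s.+1) :
    'rV[R]_(2 * s.+1) :=
  delta_mx 0 (coord_index i j).

(* In [skahler_darboux] the coordinate of index (i, 0) is x_i, and that of
   index (i, j), with j != 0, is y^j_i.
   In [skahler_coframe] v is a basis, by orthonormality and cardinality. *)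
Record almost_skahler (R : realType) (s : nat) (X : manifold R (2 * s.+1)) :=
    AlmostSKahler {
  metric : components X;
  omega : 'I_s.+1 -> 'I_s.+1 -> components X;
  skahler_metric : riemannian_metric metric;
  skahler_form : forall j k, two_form (omega j k);
  skahler_closed : forall j, j != ord0 -> closed_form (omega ord0 j);
  skahler_darboux : forall p : X, exists c,
    [/\ atlas c, dom c p &
        forall j, j != ord0 -> forall q, dom c q ->
          omega ord0 j c q = \sum_(i < 2) wedge1 (dcoord R i ord0) (dcoord R i j)];
  skahler_coframe : forall (p : X) c, atlas c -> dom c p ->
    exists v : 'I_2 -> 'I_s.+1 -> 'rV[R]_(2 * s.+1),
      orthonormal_coframe (metric c p) v /\
      forall j k, omega j k c p = \sum_(i < 2) wedge1 (v i j) (v i k)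
}.

Definition adapted_coframe (R : realType) (s : nat) (X : manifold R (2 * s.+1))
    (K : almost_skahler X) (c : chart R (2 * s.+1) X) (p : X)
    (v : 'I_2 -> 'I_s.+1 -> 'rV[R]_(2 * s.+1)) : Prop :=
  orthonormal_coframe (metric K c p) v /\
  forall j k, omega K j k c p = \sum_(i < 2) wedge1 (v i j) (v i k).

(* The complexified exterior algebra of the cotangent space in a chart: [f S] is
   the coefficient of dx_S = dx_(a_1) /\ ... /\ dx_(a_k), where
   S = {a_1 < ... < a_k}. *)

Definition ext (R : realType) (n : nat) : vectType R[i] :=
  {ffun {set 'I_n} -> R[i]^o}.

(* For disjoint S and T, dx_S /\ dx_T = (-1) ^ (inversions S T) dx_(S u T). *)
Definition inversions (n : nat) (S T : {set 'I_n}) : nat :=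
  #|[set ab : 'I_n * 'I_n | [&& ab.1 \in S, ab.2 \in T & (ab.2 < ab.1)%N]]%SET|.

Definition ext_wedge (R : realType) (n : nat) (f g : ext R n) : ext R n :=
  [ffun S : {set 'I_n} => \sum_(T : {set 'I_n} | T \subset S)
     (-1) ^+ inversions T (S :\: T)%SET * (f T : R[i]) * (g (S :\: T)%SET : R[i])].

Lemma ext_wedge_is_linear (R : realType) (n : nat) (f : ext R n) :
  linear (ext_wedge f).
Proof.
move=> a u w; apply/ffunP => S; rewrite !ffunE.
rewrite scaler_sumr -big_split /=; apply: eq_bigr => T _.
by rewrite !ffunE mulrDr; congr (_ + _); rewrite mulrCA.
Qed.

HB.instance Definition _ (R : realType) (n : nat) (f : ext R n) :=
  GRing.isLinear.Build R[i] (ext R n) (ext R n) _ (ext_wedge f)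
    (ext_wedge_is_linear f).

Definition covector (R : realType) (n : nat) (v : 'rV[R]_n) : ext R n :=
  [ffun S : {set 'I_n} => \sum_(a < n | S == [set a]%SET) (v 0 a)%:C].

(* The Hermitian metric induced by G, antilinear in the second argument:
   <dx_S, dx_T> = det (<dx_a, dx_b>), for a in S and b in T in increasing order,
   when #|S| = #|T|; the default value of [nth] is then irrelevant. *)
Definition gram (R : realType) (n : nat) (G : 'M[R]_n) (S T : {set 'I_n}) : R :=
  if #|S| == #|T| then
    \det (\matrix_(i < #|S|, j < #|S|)
      invmx G (enum_val i) (nth (enum_val i) (enum T) j))
  else 0.

Definition ext_herm (R : realType) (n : nat) (G : 'M[R]_n) (f g : ext R n) :
    R[i] :=
  \sum_S \sum_T (f S : R[i]) * Num.conj (g T : R[i]) * (gram G S T)%:C.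

Definition op (R : realType) (n : nat) := 'End(ext R n).

Definition ext_adjoint (R : realType) (n : nat) (G : 'M[R]_n) (A : op R n) : op R n :=
  xget 0 [set B : op R n |
    forall f g, ext_herm G (A f) g = ext_herm G f (B g)].

Definition opE (R : realType) (n : nat) (v : 'rV[R]_n) : op R n :=
  linfun (ext_wedge (covector v)).

Definition opL (R : realType) (s n : nat) (v : 'I_2 -> 'I_s.+1 -> 'rV[R]_n)
    (j k : 'I_s.+1) : op R n :=
  \sum_(i < 2) (opE (v i j) \o opE (v i k))%VF.

(* The sign is that of the orientation v_1j /\ v_2j of W_j; replacing v by another
   adapted coframe changes it simultaneously for all j, or for none. *)
Definition opV (R : realType) (s n : nat) (v : 'I_2 -> 'I_s.+1 -> 'rV[R]_n)
    (j : 'I_s.+1) : op R n :=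
  (opE (v ord0 j) \o opE (v ord_max j))%VF.

Definition opLambda (R : realType) (s n : nat) (G : 'M[R]_n)
    (v : 'I_2 -> 'I_s.+1 -> 'rV[R]_n) (j k : 'I_s.+1) : op R n :=
  ext_adjoint G (opL v j k).

Definition opA (R : realType) (s n : nat) (G : 'M[R]_n)
    (v : 'I_2 -> 'I_s.+1 -> 'rV[R]_n) (j : 'I_s.+1) : op R n :=
  ext_adjoint G (opV v j).

Definition bracket (R : realType) (n : nat) (A B : op R n) : op R n :=
  (A \o B)%VF - (B \o A)%VF.

(* The real Lie algebra generated by G, inside the complex vector space of
   operators: only real scalars are allowed. *)
Inductive real_lie_gen (R : realType) (n : nat) (G : set (op R n)) :
    op R n -> Prop :=
| lie_gen A of G A : real_lie_gen G A
| lie_zero : real_lie_gen G 0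
| lie_add A B of real_lie_gen G A & real_lie_gen G B : real_lie_gen G (A + B)
| lie_scale (r : R) A of real_lie_gen G A : real_lie_gen G (r%:C *: A)
| lie_bracket A B of real_lie_gen G A & real_lie_gen G B :
    real_lie_gen G (bracket A B).

Definition Lef (R : realType) (s n : nat) (G : 'M[R]_n)
    (v : 'I_2 -> 'I_s.+1 -> 'rV[R]_n) : set (op R n) :=
  real_lie_gen [set A | exists j k, j != k /\
    (A = opL v j k \/ A = opLambda G v j k)].

Definition LR (R : realType) (s n : nat) (G : 'M[R]_n)
    (v : 'I_2 -> 'I_s.+1 -> 'rV[R]_n) : set (op R n) :=
  real_lie_gen
    ([set A | exists j k, j != k /\ (A = opL v j k \/ A = opLambda G v j k)]
     `|` [set A | exists j, A = opV v j \/ A = opA G v j]).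

Definition sL (R : realType) (s n : nat) (G : 'M[R]_n)
    (v : 'I_2 -> 'I_s.+1 -> 'rV[R]_n) : set (op R n) :=
  real_lie_gen
    ([set A | exists j k, j != k /\ (A = opL v j k \/ A = opLambda G v j k)]
     `|` [set A | exists j, A = 'i *: opV v j \/ A = 'i *: opA G v j]).

Definition so (R : realType) (p q : nat) : set 'M[R]_(p + q) :=
  [set M | let eta := block_mx 1%:M 0 0 (- 1%:M) in
           M^T *m eta + eta *m M = 0].

Definition real_lie_iso (R : realType) (n m : nat) (g : set (op R n))
    (h : set 'M[R]_m) : Prop :=
  exists phi : op R n -> 'M[R]_m,
    [/\ set_bij g h phi,
        forall A B, g A -> g B -> phi (A + B) = phi A + phi B,
        forall (r : R) A, g A -> phi (r%:C *: A) = r *: phi A &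
        forall A B, g A -> g B ->
          phi (bracket A B) = phi A *m phi B - phi B *m phi A].

(* Main.v *)
Require Import Defs.
From HB Require Import structures.
From mathcomp Require Import all_boot all_order all_algebra.
From mathcomp Require Import all_classical all_reals all_analysis.
From mathcomp Require Import complex ring.

(* Write chi_(i,a) for the operators E_ij and their adjoints, a running over
   2 (s + 1) values. They satisfy the relations of a Clifford algebra, with the
   hyperbolic form h on the index a. For a skew complex matrix B put
   Q B = \sum B_cd chi_c chi_d; then [Q B, Q C] = 2 Q (B H C - C H B), and Q is
   injective on skew matrices. In blocks indexed by i, the algebra Lef is the
   image of the matrices [[M, 0], [0, M]] with M real and skew, whereas LR and sL
   lie in the images of [[M, S], [-S, M]] and [[M, 'i S], [-'i S, M]], with S real
   and symmetric. Real matrices with S = 'i S' vanish, so LR and sL meet in Lef.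
   Finally M |-> 2 M h identifies Lef with the orthogonal Lie algebra of h, and h
   is conjugate to diag(1, -1) up to a factor. *)

Set Implicit Arguments.
Unset Strict Implicit.
Unset Printing Implicit Defensive.
Import Order.TTheory GRing.Theory Num.Theory.
Local Open Scope ring_scope.
Local Open Scope complex_scope.
Local Open Scope classical_set_scope.

(** * Quadratic elements of a Clifford algebra *)

Section Bilinear.
Variables (F : comNzRingType) (A : algType F).

(** With f = g this is the quadratic element Q M of the matrix M. Two families are allowed so that
    the blocks of a matrix can be evaluated separately. *)
Definition bilsum p q (f : 'I_p -> A) (g : 'I_q -> A) (M : 'M[F]_(p, q)) : A :=
  \sum_a \sum_b M a b *: (f a * g b).

Variables (p q : nat) (f : 'I_p -> A) (g : 'I_q -> A).

Lemma bilsumD M N : bilsum f g (M + N) = bilsum f g M + bilsum f g N.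
Proof.
rewrite /bilsum -big_split; apply: eq_bigr => a _ /=.
rewrite -big_split; apply: eq_bigr => b _ /=.
by rewrite mxE scalerDl.
Qed.

Lemma bilsumZ k M : bilsum f g (k *: M) = k *: bilsum f g M.
Proof.
rewrite /bilsum scaler_sumr; apply: eq_bigr => a _ /=.
by rewrite scaler_sumr; apply: eq_bigr => b _ /=; rewrite mxE scalerA.
Qed.

HB.instance Definition _ := GRing.isLinear.Build F 'M[F]_(p, q) A _ (bilsum f g)
  (fun k M N => etrans (bilsumD _ _) (congr1 (+%R^~ _) (bilsumZ k M))).

Lemma bilsum0 : bilsum f g 0 = 0.
Proof. exact: linear0. Qed.

Lemma bilsumB M N : bilsum f g (M - N) = bilsum f g M - bilsum f g N.
Proof. exact: linearB. Qed.

Lemma bilsum_delta a b : bilsum f g (delta_mx a b) = f a * g b.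
Proof.
rewrite /bilsum (bigD1 a) //= (bigD1 b) //= !mxE !eqxx /= scale1r.
rewrite !big1 ?addr0 // => [i /negPf ia|i /negPf ib].
  by rewrite big1 // => j _; rewrite mxE ia scale0r.
by rewrite mxE eqxx ib scale0r.
Qed.

End Bilinear.

Lemma bilsum_block (F : comNzRingType) (A : algType F) p (chi : 'I_(p + p) -> A)
    (B C D E : 'M[F]_p) :
  let f a := chi (lshift p a) in let g a := chi (rshift p a) in
  bilsum chi chi (block_mx B C D E) =
  bilsum f f B + bilsum f g C + (bilsum g f D + bilsum g g E).
Proof.
move=> f g; rewrite /bilsum big_split_ord /=; congr (_ + _); rewrite -big_split /=.
  apply: eq_bigr => a _; rewrite big_split_ord /=; congr (_ + _);
  by apply: eq_bigr => b _; rewrite ?block_mxEul ?block_mxEur.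
apply: eq_bigr => a _; rewrite big_split_ord /=; congr (_ + _);
by apply: eq_bigr => b _; rewrite ?block_mxEdl ?block_mxEdr.
Qed.

Section Clifford.
Variables (F : comNzRingType) (A : algType F) (m : nat).
Variables (chi : 'I_m -> A) (H : 'M[F]_m).
Hypothesis sym_H : H^T = H.
Hypothesis chiP : forall a b, chi a * chi b + chi b * chi a = (H a b)%:A.

Local Notation quad := (bilsum chi chi).

(** Moving chi_c across chi_a chi_b takes two Clifford relations and leaves H b c chi_a - H a c
    chi_b. Skewness of M makes the two resulting sums equal, hence the factor 2: [quad M] acts on
    the span of the chi by the matrix 2 M H. *)
Lemma commutator_quad_chi M c : M^T = - M ->
  quad M * chi c - chi c * quad M = \sum_a (M *m H *+ 2) a c *: chi a.
Proof.
move=> asM.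
have swap a b : chi a * chi b * chi c - chi c * (chi a * chi b)
    = H b c *: chi a - H a c *: chi b.
  have anti d e : chi d * chi e = (H d e)%:A - chi e * chi d.
    by rewrite -chiP addrK.
  rewrite -mulrA [chi b * chi c]anti mulrBr !mulrA.
  rewrite [chi c * chi a]anti mulrBl opprB addrA addrNK.
  by rewrite -scalerAr mulr1 mulr_algl -[in H c a]sym_H mxE.
rewrite /bilsum mulr_suml mulr_sumr -sumrB.
transitivity (\sum_a \sum_b M a b *: (H b c *: chi a - H a c *: chi b)).
  apply: eq_bigr => a _; rewrite mulr_suml mulr_sumr -sumrB.
  apply: eq_bigr => b _.
  by rewrite -scalerAl -scalerAr -scalerBr swap.
under eq_bigr => a _ do
  (under eq_bigr => b _ do rewrite scalerBr !scalerA; rewrite sumrB).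
rewrite sumrB [X in _ - X]exchange_big -sumrB; apply: eq_bigr => a _.
rewrite -!scaler_suml -scalerBl -sumrB mulr2n mxE !mxE -big_split /=.
congr (_ *: _); apply: eq_bigr => b _.
have -> : M b a = - M a b by have /matrixP/(_ a b) := asM; rewrite !mxE.
by rewrite mulNr opprK.
Qed.

(** The commutator with [quad M] is a derivation, so it acts on each factor of chi_c chi_d by X = 2
    M H. This replaces N by X N + N X^T, where X^T = - 2 H M because M is skew. *)
Lemma commutator_quad M N : M^T = - M -> N^T = - N ->
  quad M * quad N - quad N * quad M
    = quad ((M *m H *m N - N *m H *m M) *+ 2).
Proof.
move=> asM asN.
set X := M *m H *+ 2.
have -> : (M *m H *m N - N *m H *m M) *+ 2 = X *m N + N *m X^T.
  rewrite /X !mulr2n linearD /= trmx_mul sym_H asM mulmxN mulmxDl mulmxDr.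
  by rewrite mulmxN mulmxA addrACA.
transitivity (\sum_c \sum_d N c d *: ((\sum_a X a c *: chi a) * chi d
                                     + chi c * \sum_a X a d *: chi a)).
  transitivity (\sum_c \sum_d N c d *: (quad M * (chi c * chi d)
                                         - chi c * chi d * quad M)).
    rewrite {2 3}/bilsum; move: (quad M) => q.
    rewrite mulr_suml mulr_sumr -sumrB; apply: eq_bigr => c _.
    rewrite mulr_suml mulr_sumr -sumrB; apply: eq_bigr => d _.
    by rewrite -scalerAl -scalerAr -scalerBr.
  apply: eq_bigr => c _; apply: eq_bigr => d _; congr (_ *: _).
  rewrite -!commutator_quad_chi //.
  by rewrite mulrBl mulrBr !mulrA addrA addrNK.
under eq_bigr => c _ do (under eq_bigr => d _ do rewrite scalerDr;
  rewrite big_split /=).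
rewrite big_split /= bilsumD; congr (_ + _).
  transitivity (\sum_c \sum_d \sum_a (X a c * N c d) *: (chi a * chi d)).
    apply: eq_bigr => c _; apply: eq_bigr => d _.
    rewrite mulr_suml scaler_sumr; apply: eq_bigr => a _.
    by rewrite -scalerAl scalerA mulrC.
  rewrite /bilsum exchange_big /=; under eq_bigr do rewrite exchange_big /=.
  rewrite exchange_big /=; apply: eq_bigr => a _; apply: eq_bigr => d _.
  by rewrite -scaler_suml mxE.
rewrite /bilsum; apply: eq_bigr => c _.
transitivity (\sum_d \sum_a (N c d * X a d) *: (chi c * chi a)).
  apply: eq_bigr => d _.
  rewrite mulr_sumr scaler_sumr; apply: eq_bigr => a _.
  by rewrite -scalerAr scalerA.
rewrite exchange_big /=; apply: eq_bigr => a _.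
rewrite -scaler_suml mxE; congr (_ *: _); apply: eq_bigr => d _.
by rewrite [X^T _ _]mxE.
Qed.

(** The commutator Z lies in the span of the chi, so its anticommutator with chi_d is a scalar. This
    scalar reads off an entry of 2 H M H, which allows M to be recovered from [quad M]. *)
Lemma anticommutator_chi_commutator_quad M d c : M^T = - M ->
  let Z := quad M * chi c - chi c * quad M in
  chi d * Z + Z * chi d = ((H *m M *m H *+ 2) d c)%:A.
Proof.
move=> asM /=; rewrite commutator_quad_chi // mulr_suml mulr_sumr -big_split.
have -> : H *m M *m H *+ 2 = H *m (M *m H *+ 2).
  by rewrite -mulmxA !mulr2n mulmxDr.
rewrite mxE scaler_suml; apply: eq_bigr => a _ /=.
by rewrite -scalerAl -scalerAr -scalerDr chiP scalerA mulrC.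
Qed.

End Clifford.

Lemma bilsum_skew_inj (F : numFieldType) (A : algType F) m (chi : 'I_m -> A)
    (H : 'M[F]_m) (M : 'M[F]_m) :
  H^T = H -> H *m H = 1%:M ->
  (forall a b, chi a * chi b + chi b * chi a = (H a b)%:A) ->
  M^T = - M -> bilsum chi chi M = 0 -> M = 0.
Proof.
move=> sH HH chiP asM M0.
have : H *m M *m H = 0.
  apply/matrixP => d c; rewrite [RHS]mxE.
  have := anticommutator_chi_commutator_quad sH chiP d c asM; cbv zeta.
  have -> : bilsum chi chi M * chi c - chi c * bilsum chi chi M = 0.
    by rewrite M0 mul0r mulr0 subrr.
  rewrite mulr0 mul0r addr0 => /esym/eqP.
  rewrite scaler_eq0 oner_eq0 orbF -scaler_nat [(_ *: _ : 'M[F]_m) d c]mxE.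
  by rewrite mulf_eq0 pnatr_eq0 => /eqP.
(* H is an involution, so multiplying H M H by H on both sides returns M. *)
move=> /(congr1 (fun X => H *m X *m H)).
by rewrite mulmx0 mul0mx !mulmxA HH mul1mx -mulmxA HH mulmx1.
Qed.

(** * Fermionic operators in coordinates *)

Section Sets.
Variable n : nat.
Implicit Types (a b : 'I_n) (S T : {set 'I_n}).

(** The number of transpositions that bring dx_a to its place in front of dx_S; it governs every
    sign of the wedge product and of the contraction. *)
Definition below a S := #|[set b in S | (b < a)%N]%SET|.

Lemma below_setU1 a b S : b \notin S -> below a (b |: S)%SET = ((b < a) + below a S)%N.
Proof.
move=> bS; rewrite /below.
have -> : [set c in b |: S | (c < a)%N]%SET
    = (if (b < a)%N then b |: [set c in S | (c < a)%N]
       else [set c in S | (c < a)%N])%SET.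
  apply/setP => c; rewrite !inE; case: ifP => ba; rewrite !inE.
    by case: eqP => [->|]; rewrite ?ba.
  by case: eqP => [->|]; rewrite ?ba ?andbF.
by case: ifP => ba //; rewrite cardsU1 !inE (negPf bS).
Qed.

Lemma below_setD1 a b S : b \in S -> below a S = ((b < a) + below a (S :\ b)%SET)%N.
Proof. by move=> bS; rewrite -{1}(finset.setD1K bS) below_setU1 // !inE eqxx. Qed.

Lemma below_lt a S : a \in S -> (below a S < #|S|)%N.
Proof.
move=> aS; rewrite /below [ltnRHS](cardsD1 a) aS ltnS.
apply: subset_leq_card; apply/fintype.subsetP => c; rewrite !inE => /andP[-> lt_c].
by rewrite andbT; apply: contraTneq lt_c => ->; rewrite ltnn.
Qed.

Lemma sorted_enum_ord S : sorted (fun a b => a < b)%N (enum S).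
Proof.
rewrite /enum_mem; apply: sorted_filter => [x y z|]; first exact: ltn_trans.
by rewrite -(@sorted_map _ _ val ltn) -enumT val_enum_ord iota_ltn_sorted.
Qed.

(** Matches the removal of an element from a set with the deletion of a row or column in a Laplace
    expansion, where [bump] skips the deleted position. *)
Lemma nth_enum_setD1 x b T : b \in T ->
  nth x (enum T) (below b T) = b /\
  forall k, nth x (enum T) (bump (below b T) k) = nth x (enum (T :\ b)%SET) k.
Proof.
move=> bT.
have := sorted_enum_ord T; have := enum_uniq T.
have : below b T = size [seq c : 'I_n <- enum T | (c < b)%N].
  rewrite /below cardE; congr size.
  rewrite /enum_mem -filter_predI; apply: eq_filter => c /=; by rewrite !inE andbC.
have : enum (T :\ b)%SET = [seq c <- enum T | c != b].
  rewrite /enum_mem -filter_predI; apply: eq_filter => c /=; by rewrite !inE.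
have : b \in enum T by rewrite mem_enum.
(* The enumeration is cut at b. Being strictly increasing, it has only smaller indices in s1 and
   only larger ones in s2, so the position of b is the size of s1. *)
case/splitPr: (enum T) / => s1 s2 -> -> us.
rewrite sorted_pairwise; last by move=> y x' z; exact: ltn_trans.
rewrite pairwise_cat allrel_consr pairwise_cons => /and3P[/andP[s1b _] _ /andP[bs2 _]].
move: us; rewrite cat_uniq /= negb_or => /and4P[_ /andP[bs1 _] bs2' _].
have s1E : [seq c : 'I_n <- s1 | (c < b)%N] = s1 by apply/all_filterP.
have s2E : [seq c : 'I_n <- s2 | (c < b)%N] = [::].
  apply/eqP; rewrite -[_ == _]negbK -has_filter -all_predC.
  by apply: sub_all bs2 => c bc /=; rewrite -leqNgt ltnW.
have s1E' : [seq c : 'I_n <- s1 | c != b] = s1.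
  by apply/all_filterP/allP => c cs1; apply: contraNneq bs1 => <-.
have s2E' : [seq c : 'I_n <- s2 | c != b] = s2.
  by apply/all_filterP/allP => c cs2; apply: contraNneq bs2' => <-.
rewrite !filter_cat /= ltnn eqxx s1E s2E s1E' s2E' cats0 /=.
split=> [|k]; first by rewrite nth_cat ltnn subnn.
rewrite !nth_cat /bump; case: (leqP (size s1) k) => k1; last by rewrite add0n k1.
by rewrite add1n ltnNge leqW //= subSn.
Qed.
End Sets.

(** * Laplace expansion of Gram determinants *)

Section Gram.
Variables (R : realType) (n : nat) (G : 'M[R]_n).
Implicit Types (a b : 'I_n) (S T : {set 'I_n}).

(** Rows and columns are selected by functions on [nat], so that the size m is independent of the
    index sets and no casts between matrix types arise; values from m on are irrelevant. *)
Definition minor m (r t : nat -> 'I_n) : R :=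
  \det (\matrix_(i < m, j < m) invmx G (r i) (t j)).

Lemma eq_minor m r r' t t' : (forall k, (k < m)%N -> r k = r' k) ->
  (forall k, (k < m)%N -> t k = t' k) -> minor m r t = minor m r' t'.
Proof.
move=> rr' tt'; congr (\det _); apply/matrixP => i j.
by rewrite !mxE rr' // tt'.
Qed.

Lemma minor_laplace m (i : 'I_m.+1) r t :
  minor m.+1 r t = \sum_(j < m.+1) invmx G (r i) (t j)
    * ((-1) ^+ (i + j) * minor m (r \o bump i) (t \o bump j)).
Proof.
rewrite /minor (expand_det_row _ i); apply: eq_bigr => j _.
rewrite mxE; congr (_ * (_ * \det _)).
by apply/matrixP => k l; rewrite !mxE.
Qed.

Lemma gramE x S T : #|S| = #|T| ->
  gram G S T = minor #|S| (nth x (enum S)) (nth x (enum T)).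
Proof.
move=> ST; rewrite /gram; case: eqP => [_|//]; congr (\det _); apply/matrixP => i j.
rewrite !mxE (enum_val_nth x); congr (invmx G _ _).
by apply: set_nth_default; rewrite -cardE; case: j => j /=; rewrite ST.
Qed.

Lemma gram_neq S T : #|S| != #|T| -> gram G S T = 0.
Proof. by rewrite /gram => /negPf ->. Qed.

Lemma gram_set0 : gram G finset.set0 finset.set0 = 1.
Proof.
rewrite /gram eqxx; move: (\matrix_(i, j) _).
by rewrite cards0 => M; exact: det_mx00.
Qed.

(** Laplace expansion along the row i that carries a. The row selection r is left free so as to
    cover both the sorted set a |: S and a list in which a occurs twice. *)
Lemma minor_setD1 (a : 'I_n) S T m (i : 'I_m.+1) (r : nat -> 'I_n) :
  #|S| = m -> #|T| = m.+1 ->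
  r i = a -> (forall k, r (bump i k) = nth a (enum S) k) ->
  minor m.+1 r (nth a (enum T)) =
  (-1) ^+ i * \sum_(b in T) invmx G a b * (-1) ^+ below b T * gram G S (T :\ b)%SET.
Proof.
move=> Sm Tm ra rS; rewrite (minor_laplace i) [in RHS]big_enum_val /= mulr_sumr.
under [RHS]eq_bigr do rewrite (enum_val_nth a).
rewrite -(big_mkord xpredT (fun j => (-1) ^+ i * (invmx G a (nth a (enum T) j)
  * (-1) ^+ below (nth a (enum T) j) T * gram G S (T :\ nth a (enum T) j)%SET))).
rewrite Tm big_mkord; apply: eq_bigr => j _; rewrite ra.
have jT : (j < size (enum T))%N by rewrite -cardE Tm.
have bT : nth a (enum T) j \in T by rewrite -mem_enum mem_nth.
have [nth_b nth_bump] := nth_enum_setD1 a bT.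
have bj : below (nth a (enum T) j) T = j.
  apply/eqP; rewrite -(nth_uniq a _ jT (enum_uniq T)) ?nth_b //.
  by rewrite -cardE below_lt.
have TDm : #|(T :\ nth a (enum T) j)%SET| = m.
  by have := cardsD1 (nth a (enum T) j) T; rewrite bT Tm => -[].
rewrite bj in nth_bump *; rewrite (gramE a) ?TDm // Sm exprD.
rewrite (@eq_minor _ (r \o bump i) (nth a (enum S)) _
  (nth a (enum (T :\ nth a (enum T) j)%SET))) => [|k _|k _] /=.
  by rewrite -!mulrA mulrCA; congr (_ * _); rewrite mulrCA.
  by rewrite rS.
by rewrite nth_bump.
Qed.

(** Expansion along the row of a, which has position [below a S] in the sorted set a |: S; this
    accounts for the sign on the left. *)
Lemma gram_setU1 a S T : a \notin S ->
  (-1) ^+ below a S * gram G (a |: S)%SET T =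
  \sum_(b in T) invmx G a b * (-1) ^+ below b T * gram G S (T :\ b)%SET.
Proof.
(* If the cardinalities do not match, all Gram determinants on both sides vanish by convention. *)
move=> aS; have [Tm|Tm] := eqVneq #|T| #|S|.+1; last first.
  rewrite gram_neq ?mulr0; last by rewrite cardsU1 aS eq_sym.
  rewrite big1 // => b bT; rewrite gram_neq ?mulr0 //.
  by apply: contra Tm => /eqP ->; rewrite (cardsD1 b T) bT.
have aSS : a \in (a |: S)%SET by rewrite !inE eqxx.
have [nth_a nth_bump] := nth_enum_setD1 a aSS.
have le_a : (below a (a |: S)%SET < #|S|.+1)%N.
  by rewrite below_setU1 // ltnn ltnS subset_leq_card //;
    apply/fintype.subsetP => c; rewrite inE => /andP[].
rewrite (gramE a) ?cardsU1 aS ?Tm //.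
rewrite (@minor_setD1 a S T #|S| (Ordinal le_a)) //=; last first.
  by move=> k; rewrite nth_bump finset.setU1K.
by rewrite below_setU1 // ltnn add0n signrMK.
Qed.

(* Laplace expansion of a determinant in which the row of a occurs twice. *)
Lemma gram_alternate a S T : a \in S ->
  \sum_(b in T) invmx G a b * (-1) ^+ below b T * gram G S (T :\ b)%SET = 0.
Proof.
move=> aS; have [Tm|Tm] := eqVneq #|T| #|S|.+1; last first.
  rewrite big1 // => b bT; rewrite gram_neq ?mulr0 //.
  by apply: contra Tm => /eqP ->; rewrite (cardsD1 b T) bT.
pose r k := if k is k'.+1 then nth a (enum S) k' else a.
have := @minor_setD1 a S T #|S| ord0 r erefl Tm erefl (fun k => erefl).
rewrite expr0 mul1r => <-.
have [nth_a _] := nth_enum_setD1 a aS.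
apply: (@determinant_alternate _ _ _ ord0 (lift ord0 (Ordinal (below_lt aS)))) => //.
by move=> j; rewrite !mxE /= nth_a.
Qed.
End Gram.

(** * Creation and annihilation operators *)

Section Fermions.
Variables (R : realType) (n : nat).
Implicit Types (a b : 'I_n) (S T : {set 'I_n}) (f g : ext R n) (v w : 'rV[R]_n).

(* E and its adjoint for the coordinate coframe and the standard metric. *)
Definition create a f : ext R n :=
  [ffun S : {set 'I_n} =>
    if a \in S then (-1) ^+ below a S * (f (S :\ a)%SET : R[i]) else 0].

Definition annihilate a f : ext R n :=
  [ffun S : {set 'I_n} =>
    if a \in S then 0 else (-1) ^+ below a S * (f (a |: S)%SET : R[i])].

Lemma create_is_linear a : linear (create a).
Proof.
move=> k u w; apply/ffunP => S; rewrite !ffunE; case: ifP => _; last first.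
  by rewrite scaler0 addr0.
by rewrite mulrDr; congr (_ + _); rewrite mulrCA.
Qed.

Lemma annihilate_is_linear a : linear (annihilate a).
Proof.
move=> k u w; apply/ffunP => S; rewrite !ffunE; case: ifP => _.
  by rewrite scaler0 addr0.
by rewrite mulrDr; congr (_ + _); rewrite mulrCA.
Qed.

HB.instance Definition _ a :=
  GRing.isLinear.Build R[i] (ext R n) (ext R n) _ (create a) (create_is_linear a).
HB.instance Definition _ a :=
  GRing.isLinear.Build R[i] (ext R n) (ext R n) _ (annihilate a)
    (annihilate_is_linear a).

Lemma create_anticommute a b f : create a (create b f) + create b (create a f) = 0.
Proof.
apply/ffunP => S; rewrite !ffunE !inE.
have [->|ab] := eqVneq a b; first by rewrite /= mulr0 if_same addr0.
rewrite /=.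
case: (boolP (a \in S)) => aS; case: (boolP (b \in S)) => bS; rewrite ?mulr0 ?addr0 //.
have -> : (S :\ b :\ a = S :\ a :\ b)%SET by rewrite !finset.setDDl finset.setUC.
rewrite !mulrA -!exprD -mulrDl (below_setD1 a bS) (below_setD1 b aS).
(* Exactly one of a < b and b < a holds, so the two orders of creation differ by one sign and
   cancel. *)
rewrite !exprD; case: (ltngtP a b) ab => [_|_|/val_inj ->]; last by rewrite eqxx.
  by move=> _ /=; ring.
by move=> _ /=; ring.
Qed.

(** For a = b exactly one term survives, according to whether a lies in S, and its sign is squared.
    For a != b the two terms differ by the sign of one transposition. *)
Lemma create_annihilate a b f :
  create a (annihilate b f) + annihilate b (create a f) = (a == b)%:R *: f.
Proof.
apply/ffunP => S; rewrite !ffunE !inE.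
have [<-|ab] := eqVneq a b; rewrite /= ?scale1r ?scale0r.
  case: (boolP (a \in S)) => aS.
    by rewrite addr0 (below_setD1 a aS) ltnn signrMK finset.setD1K.
  by rewrite add0r below_setU1 // ltnn signrMK finset.setU1K.
case: (boolP (a \in S)) => aS; case: (boolP (b \in S)) => bS;
  rewrite ?mulr0 ?addr0 //.
have -> : ((b |: S) :\ a = b |: S :\ a)%SET.
  apply/setP => c; rewrite !inE.
  by case: (eqVneq c b) => // ->; rewrite eq_sym ab.
rewrite (below_setU1 a bS) (below_setD1 b aS) !exprD.
case: (ltngtP a b) ab => [_|_|/val_inj ->]; last by rewrite eqxx.
  by move=> _ /=; ring.
by move=> _ /=; ring.
Qed.

Lemma inversions_set1 a S : inversions [set a]%SET S = below a S.
Proof.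
rewrite /inversions /below -(card_imset _ (can_inj (fun b => erefl b : snd (a, b) = b))).
congr #|pred_of_set _|; apply/setP => -[c b]; apply/idP/imsetP => /=.
  rewrite !inE => /and3P[/= /eqP-> bS ba]; exists b => //.
  by rewrite inE bS.
by case=> d; rewrite !inE => /andP[dS da] [-> ->]; rewrite eqxx dS.
Qed.

(** Since [covector v] is supported on singletons, only T = {a} contributes to the wedge product,
    and its inversion sign is the one in [create]. *)
Lemma opEE v : opE v = \sum_a (v 0 a)%:C *: linfun (create a).
Proof.
apply/lfunP => f; rewrite lfunE sum_lfunE; apply/ffunP => S /=.
rewrite sum_ffunE ffunE.
transitivity (\sum_(T : {set 'I_n} | T \subset S) \sum_(a < n | T == [set a]%SET)
  (v 0 a)%:C * ((-1) ^+ inversions T (S :\: T)%SET * (f (S :\: T)%SET : R[i]))).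
  apply: eq_bigr => T _; rewrite ffunE mulr_sumr mulr_suml.
  by apply: eq_bigr => a _; rewrite mulrAC mulrC.
rewrite (exchange_big_dep xpredT) //=; apply: eq_bigr => a _.
rewrite scale_lfunE ffunE lfunE ffunE; case: (boolP (a \in S)) => aS.
  rewrite (big_pred1 [set a]%SET) => [|T].
    by rewrite inversions_set1 (below_setD1 a aS) ltnn.
  rewrite /=; have [->|] := eqVneq T; last by rewrite andbF.
  by rewrite finset.sub1set aS.
rewrite big_pred0 ?scaler0 // => T.
have [->|] := eqVneq T; last by rewrite andbF.
by rewrite finset.sub1set (negPf aS).
Qed.

End Fermions.

(** * Adjoints for the Hermitian metric *)

(** Adding a is a bijection from the sets avoiding a onto the sets containing it. *)
Lemma sum_setU1 (V : nmodType) n (a : 'I_n) (F : {set 'I_n} -> V) :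
  \sum_(S : {set 'I_n} | a \notin S) F (a |: S)%SET =
  \sum_(S : {set 'I_n} | a \in S) F S.
Proof.
rewrite [RHS](reindex_onto (fun S => a |: S)%SET (fun S => S :\ a)%SET) /=.
  apply: eq_bigl => S; rewrite !inE eqxx /=.
  case: (boolP (a \in S)) => aS; last by rewrite finset.setU1K ?eqxx.
  by apply/esym/eqP => E; move: aS; rewrite -E !inE eqxx.
by move=> S; exact: finset.setD1K.
Qed.

Section Adjoint.
Variables (R : realType) (n : nat) (G : 'M[R]_n).
Implicit Types (a b : 'I_n) (S T : {set 'I_n}) (f g : ext R n) (v w : 'rV[R]_n).

Lemma ext_hermDl f f' g : ext_herm G (f + f') g = ext_herm G f g + ext_herm G f' g.
Proof.
rewrite /ext_herm -big_split; apply: eq_bigr => S _; rewrite -big_split.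
by apply: eq_bigr => T _; rewrite ffunE /= !mulrDl.
Qed.

Lemma ext_hermZl (k : R[i]) f g : ext_herm G (k *: f) g = k * ext_herm G f g.
Proof.
rewrite /ext_herm mulr_sumr; apply: eq_bigr => S _; rewrite mulr_sumr.
by apply: eq_bigr => T _; rewrite ffunE /= -!mulrA.
Qed.

Lemma ext_hermDr f g g' : ext_herm G f (g + g') = ext_herm G f g + ext_herm G f g'.
Proof.
rewrite /ext_herm -big_split; apply: eq_bigr => S _; rewrite -big_split.
by apply: eq_bigr => T _; rewrite ffunE /= rmorphD mulrDr mulrDl.
Qed.

Lemma ext_hermZr (k : R[i]) f g :
  ext_herm G f (k *: g) = Num.conj k * ext_herm G f g.
Proof.
rewrite /ext_herm mulr_sumr; apply: eq_bigr => S _; rewrite mulr_sumr.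
by apply: eq_bigr => T _; rewrite ffunE /= rmorphM; ring.
Qed.

Lemma conj_real_complex (x : R) : Num.conj x%:C = x%:C.
Proof. exact: conjc_real. Qed.

Lemma ext_herm0l g : ext_herm G 0 g = 0.
Proof. by rewrite -(scale0r 0) ext_hermZl mul0r. Qed.

Lemma ext_herm0r f : ext_herm G f 0 = 0.
Proof. by rewrite -(scale0r 0) ext_hermZr rmorph0 mul0r. Qed.

Lemma ext_herm_suml (I : Type) (r : seq I) P (F : I -> ext R n) g :
  ext_herm G (\sum_(i <- r | P i) F i) g = \sum_(i <- r | P i) ext_herm G (F i) g.
Proof.
exact: (big_morph (ext_herm G ^~ g) (fun f f' => ext_hermDl f f' g)
  (ext_herm0l g)).
Qed.

Lemma ext_herm_sumr (I : Type) (r : seq I) P (F : I -> ext R n) f :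
  ext_herm G f (\sum_(i <- r | P i) F i) = \sum_(i <- r | P i) ext_herm G f (F i).
Proof. exact: (big_morph (ext_herm G f) (ext_hermDr f) (ext_herm0r f)). Qed.

(** This is Laplace expansion in the row of a: it says that creation and annihilation are adjoint up
    to the matrix [invmx G]. *)
Lemma ext_herm_create a f g :
  ext_herm G (create a f) g =
  \sum_b (invmx G a b)%:C * ext_herm G f (annihilate b g).
Proof.
(* c S T is the coefficient of f S times the conjugate of g T on both sides. On the left it comes
   from [gram_setU1] if a is not in S, and it is zero by [gram_alternate] otherwise. *)
pose c S T : R := \sum_(b in T)
  invmx G a b * (-1) ^+ below b T * gram G S (T :\ b)%SET.
transitivity (\sum_S \sum_T (f S : R[i]) * Num.conj (g T : R[i]) * (c S T)%:C).
  rewrite [RHS](bigID (fun S : {set _} => a \in S)) /= [X in _ = X + _]big1 => [|S aS].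
    rewrite add0r /ext_herm (bigID (fun S : {set _} => a \in S)) /= addrC big1 => [|S aS].
      rewrite add0r -sum_setU1; apply: eq_bigr => S aS; apply: eq_bigr => T _.
      rewrite !ffunE !inE eqxx /= below_setU1 // ltnn finset.setU1K //.
      rewrite /c -(gram_setU1 _ _ aS) rmorphM rmorph_sign /=; ring.
    by apply: big1 => T _; rewrite ffunE (negPf aS) !mul0r.
  by apply: big1 => T _; rewrite /c gram_alternate // mulr0.
under [RHS]eq_bigr do rewrite mulr_sumr.
rewrite [RHS]exchange_big; apply: eq_bigr => S _ /=.
under [RHS]eq_bigr do rewrite mulr_sumr.
transitivity (\sum_b \sum_(T : {set 'I_n} | b \in T) (f S : R[i])
  * Num.conj (g T : R[i])
  * (invmx G a b * (-1) ^+ below b T * gram G S (T :\ b)%SET)%:C).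
  rewrite (exchange_big_dep xpredT) //=; apply: eq_bigr => T _.
  by rewrite /c rmorph_sum mulr_sumr.
apply: eq_bigr => b _; rewrite -sum_setU1 [RHS](bigID (fun T : {set _} => b \in T)) /=.
rewrite [X in _ = X + _]big1 => [|T bT]; last first.
  by rewrite ffunE bT rmorph0 mulr0 mul0r mulr0.
rewrite add0r; apply: eq_bigr => T bT; rewrite ffunE (negPf bT).
rewrite below_setU1 // ltnn finset.setU1K // !rmorphM !rmorph_sign /=.
ring.
Qed.

(** As [ext_adjoint] is a choice among the operators in this relation, adjoints are first exhibited
    as pairs; uniqueness ([ext_adjointE]) then turns pairs into values. *)
Definition adjoint_pair (A B : op R n) : Prop :=
  forall f g, ext_herm G (A f) g = ext_herm G f (B g).

Lemma adjoint_pair_comp A A' B B' : adjoint_pair A B -> adjoint_pair A' B' ->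
  adjoint_pair (A \o A')%VF (B' \o B)%VF.
Proof. by move=> AB AB' f g; rewrite !comp_lfunE /= AB AB'. Qed.

Lemma adjoint_pairD A A' B B' : adjoint_pair A B -> adjoint_pair A' B' ->
  adjoint_pair (A + A') (B + B').
Proof. by move=> AB AB' f g; rewrite !add_lfunE ext_hermDl ext_hermDr AB AB'. Qed.

Lemma adjoint_pair0 : adjoint_pair 0 0.
Proof. by move=> f g; rewrite !zero_lfunE ext_herm0l ext_herm0r. Qed.

Lemma adjoint_pair_sum (I : finType) (A B : I -> op R n) :
  (forall i, adjoint_pair (A i) (B i)) ->
  adjoint_pair (\sum_i A i) (\sum_i B i).
Proof.
move=> AB; apply: (big_rec2 adjoint_pair); first exact: adjoint_pair0.
by move=> i C D _; exact: adjoint_pairD.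
Qed.

(** Contraction with the vector metrically dual to v, whose components are [v *m invmx G]. *)
Definition contract v : op R n :=
  \sum_b ((v *m invmx G) 0 b)%:C *: linfun (annihilate b).

Lemma adjoint_pair_opE v : adjoint_pair (opE v) (contract v).
Proof.
move=> f g; rewrite opEE /contract !sum_lfunE ext_herm_suml ext_herm_sumr.
under eq_bigr do rewrite scale_lfunE lfunE ext_hermZl ext_herm_create mulr_sumr.
rewrite exchange_big; apply: eq_bigr => b _ /=.
rewrite scale_lfunE lfunE ext_hermZr conj_real_complex mxE rmorph_sum mulr_suml.
by apply: eq_bigr => a _; rewrite rmorphM /= mulrA.
Qed.

Lemma opE_anticommute v w : (opE v \o opE w)%VF + (opE w \o opE v)%VF = 0.
Proof.
apply/lfunP => f; rewrite add_lfunE zero_lfunE !comp_lfunE !opEE !sum_lfunE.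
transitivity (\sum_a \sum_b ((v 0 a)%:C * (w 0 b)%:C) *:
   (create a (create b f) + create b (create a f))); last first.
  by rewrite big1 // => a _; rewrite big1 // => b _;
     rewrite create_anticommute scaler0.
under [RHS]eq_bigr => a _ do (under eq_bigr => b _ do rewrite scalerDr;
  rewrite big_split).
rewrite big_split /=; congr (_ + _).
  apply: eq_bigr => a _; rewrite scale_lfunE lfunE.
  rewrite linear_sum scaler_sumr /=; apply: eq_bigr => b _.
  by rewrite scale_lfunE lfunE linearZ /= scalerA.
rewrite exchange_big; apply: eq_bigr => b _; rewrite scale_lfunE lfunE.
rewrite linear_sum scaler_sumr /=; apply: eq_bigr => a _.
by rewrite scale_lfunE lfunE linearZ /= scalerA mulrC.
Qed.

Lemma opE_contract v w :
  (opE v \o contract w)%VF + (contract w \o opE v)%VF = (cometric G w v)%:C *: \1%VF.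
Proof.
apply/lfunP => f; rewrite add_lfunE scale_lfunE !comp_lfunE opEE /contract !sum_lfunE.
transitivity (\sum_a \sum_b ((v 0 a)%:C * ((w *m invmx G) 0 b)%:C) *:
   (create a (annihilate b f) + annihilate b (create a f))).
  under [RHS]eq_bigr => a _ do (under eq_bigr => b _ do rewrite scalerDr;
    rewrite big_split).
  rewrite big_split /=; congr (_ + _).
    apply: eq_bigr => a _; rewrite scale_lfunE lfunE.
    rewrite linear_sum scaler_sumr /=; apply: eq_bigr => b _.
    by rewrite scale_lfunE lfunE linearZ /= scalerA.
  rewrite exchange_big; apply: eq_bigr => b _; rewrite scale_lfunE lfunE.
  rewrite linear_sum scaler_sumr /=; apply: eq_bigr => a _.
  by rewrite scale_lfunE lfunE linearZ /= scalerA mulrC.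
rewrite lfunE /= /cometric mxE rmorph_sum scaler_suml; apply: eq_bigr => a _.
rewrite (bigD1 a) //= big1 => [|b ba]; last first.
  by rewrite create_annihilate eq_sym (negPf ba) scale0r scaler0.
by rewrite create_annihilate eqxx scale1r addr0 rmorphM mulrC !mxE.
Qed.

Hypothesis unitG : G \in unitmx.

(** Inverts [ext_herm_create] by means of G *m invmx G = 1. *)
Lemma ext_herm_annihilate b f g :
  ext_herm G f (annihilate b g) = \sum_a (G b a)%:C * ext_herm G (create a f) g.
Proof.
under eq_bigr do rewrite ext_herm_create mulr_sumr.
rewrite exchange_big (bigD1 b) //= [X in _ = _ + X]big1 ?addr0 => [|c cb].
  under eq_bigr do rewrite mulrA -rmorphM.
  rewrite -mulr_suml -rmorph_sum /=.
  have := congr1 (fun M : 'M[R]_n => M b b) (mulmxV unitG).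
  by rewrite !mxE eqxx => ->; rewrite mul1r.
under eq_bigr do rewrite mulrA -rmorphM.
rewrite -mulr_suml -rmorph_sum /=.
have := congr1 (fun M : 'M[R]_n => M b c) (mulmxV unitG).
by rewrite !mxE eq_sym (negPf cb) => ->; rewrite mul0r.
Qed.

(* The radical of the form is stable under [annihilate]; annihilating the indices
   in T one by one reduces the coefficient g T to the case T = set0. *)
Lemma ext_herm_nondegenerate g : (forall f, ext_herm G f g = 0) -> g = 0.
Proof.
move=> g0; apply/ffunP => T; rewrite [RHS]ffunE.
have [m] := ubnP #|T|; elim: m => // m IH in T g g0 *.
have [->|/set0Pn[b bT]] := eqVneq T finset.set0 => Tm.
  have := g0 [ffun S : {set 'I_n} => (S == finset.set0)%:R].
  rewrite /ext_herm (bigD1 finset.set0) //= [X in _ + X]big1 => [|S S0].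
    rewrite addr0 (bigD1 finset.set0) //= big1 ?addr0 => [|S S0].
      rewrite ffunE eqxx gram_set0 mul1r mulr1 => /eqP.
      by rewrite fmorph_eq0 => /eqP.
    by rewrite gram_neq ?mulr0 // cards0 eq_sym cards_eq0.
  by apply: big1 => U _; rewrite ffunE (negPf S0) !mul0r.
have := IH (T :\ b)%SET (annihilate b g).
rewrite ffunE !inE eqxx /= finset.setD1K // => /(_ _ _)/eqP.
rewrite mulf_eq0 signr_eq0 /= => gT; apply/eqP/gT.
  by move=> f; rewrite ext_herm_annihilate big1 // => a _; rewrite g0 mulr0.
by move: Tm; rewrite (cardsD1 b T) bT.
Qed.

Lemma adjoint_pair_inj A B B' : adjoint_pair A B -> adjoint_pair A B' -> B = B'.
Proof.
move=> AB AB'; apply/lfunP => g; apply/eqP; rewrite -subr_eq0; apply/eqP.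
apply: ext_herm_nondegenerate => f.
by rewrite -scaleN1r ext_hermDr ext_hermZr rmorphN1 mulN1r -AB AB' subrr.
Qed.

Lemma ext_adjointE A B : adjoint_pair A B -> ext_adjoint G A = B.
Proof. by move=> AB; apply: xget_unique => // B' AB'; exact: adjoint_pair_inj AB' AB. Qed.

(** The adjoint of [opE_anticommute]; uniqueness of adjoints replaces a second sign computation. *)
Lemma contract_anticommute v w :
  (contract v \o contract w)%VF + (contract w \o contract v)%VF = 0.
Proof.
apply: (adjoint_pair_inj _ adjoint_pair0); rewrite -(opE_anticommute w v).
by apply: adjoint_pairD; apply: adjoint_pair_comp; exact: adjoint_pair_opE.
Qed.

End Adjoint.

(** * The algebra of operators under composition *)

Section OpAlgebra.
Variables (R : realType) (n : nat).

Lemma op1_neq0 : \1%VF != 0 :> op R n.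
Proof.
apply/eqP => /lfunP/(_ [ffun=> 1])/ffunP/(_ finset.set0)/eqP.
by rewrite !lfunE /= !ffunE oner_eq0.
Qed.

(* The structure [lfun_algType] of the library carries the opposite product. *)
Definition op_nzRing : nzRingType :=
  HB.pack 'End(ext R n) (GRing.Zmodule_isNzRing.Build 'End(ext R n)
  (@comp_lfunA _ _ _ _ _) (@comp_lfun1l _ _ _) (@comp_lfun1r _ _ _)
  (@comp_lfunDl _ _ _ _) (@comp_lfunDr _ _ _ _) op1_neq0).
Definition op_lalg : lalgType R[i] :=
  HB.pack 'End(ext R n) op_nzRing
  (GRing.Lmodule_isLalgebra.Build R[i] op_nzRing (@comp_lfunZl _ _ _ _)).
Definition op_alg : algType R[i] :=
  HB.pack 'End(ext R n) op_lalg
  (GRing.Lalgebra_isAlgebra.Build R[i] op_lalg (@comp_lfunZr _ _ _ _)).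
End OpAlgebra.

(** * Block matrices *)

Section Blocks.
Variables (R : realType) (N : nat).
Implicit Types (M S : 'M[R]_(N + N)) (z : R[i]).

(** For fixed i, the form given by anticommutators: the first N indices stand for the wedge
    operators, the last N for their adjoints. *)
Definition hypmx : 'M[R]_(N + N) := block_mx 0 1%:M 1%:M 0.

Local Notation cplx := (map_mx (real_complex R)).

Definition hypmx2 : 'M[R[i]]_(N + N + (N + N)) :=
  block_mx (cplx hypmx) 0 0 (cplx hypmx).

Definition blk z M S : 'M[R[i]]_(N + N + (N + N)) :=
  block_mx (cplx M) (z *: cplx S) (- (z *: cplx S)) (cplx M).

Lemma hypmx_sym : hypmx^T = hypmx.
Proof. by rewrite tr_block_mx !trmx0 trmx1. Qed.

Lemma hypmxK : hypmx *m hypmx = 1%:M.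
Proof.
by rewrite mulmx_block !mulmx0 !mul0mx !mulmx1 !addr0 !add0r -scalar_mx_block.
Qed.

Lemma hypmx2_sym : hypmx2^T = hypmx2.
Proof. by rewrite tr_block_mx !trmx0 map_trmx hypmx_sym. Qed.

Lemma hypmx2K : hypmx2 *m hypmx2 = 1%:M.
Proof.
by rewrite mulmx_block !mulmx0 !mul0mx !addr0 !add0r -map_mxM hypmxK map_mx1
   -scalar_mx_block.
Qed.

Lemma blk_skew z M S : M^T = - M -> S^T = S -> (blk z M S)^T = - blk z M S.
Proof.
move=> asM sS; rewrite tr_block_mx opp_block_mx linearN /= linearZ /=.
by rewrite !map_trmx asM sS map_mxN opprK.
Qed.

Lemma blkD z M S M' S' : blk z M S + blk z M' S' = blk z (M + M') (S + S').
Proof. by rewrite /blk add_block_mx !map_mxD scalerDr opprD. Qed.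

Lemma blkN z M S : - blk z M S = blk z (- M) (- S).
Proof. by rewrite /blk opp_block_mx !map_mxN scalerN. Qed.

Lemma blkZ z (r : R) M S : r%:C *: blk z M S = blk z (r *: M) (r *: S).
Proof.
by rewrite /blk scale_block_mx !map_mxZ /= scalerN !scalerA [r%:C * z]mulrC.
Qed.

Lemma blk0 z M : blk z M 0 = blk 0 M 0.
Proof. by rewrite /blk map_mx0 !scaler0. Qed.

Lemma blk_real M S : blk 0 M S = blk 0 M 0.
Proof. by rewrite /blk [in LHS]scale0r [in RHS]scale0r. Qed.

(** The product of two off-diagonal blocks enters the diagonal with the factor - z * z. If this
    square is real, the matrices M and S stay real. *)
Lemma blkM z (r : R) M S M' S' : z * z = r%:C ->
  blk z M S *m hypmx2 *m blk z M' S' =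
  blk z (M *m hypmx *m M' - r *: (S *m hypmx *m S'))
    (M *m hypmx *m S' + S *m hypmx *m M').
Proof.
move=> zz; rewrite !mulmx_block !mulmx0 !addr0 !add0r.
rewrite /blk; congr block_mx;
rewrite ?(map_mxD, map_mxN, map_mxZ, map_mxM) /= ?mulmxN ?mulNmx;
rewrite -?scalemxAl -?scalemxAr -?scalemxAl -?scalerDr ?scalerA ?zz //.
- by rewrite scalerDr opprD addrC.
- by rewrite addrC.
Qed.

Definition delta_skew a b : 'M[R]_(N + N) := delta_mx a b - delta_mx b a.

Lemma delta_skew_tr a b : (delta_skew a b)^T = - delta_skew a b.
Proof. by rewrite linearB /= !trmx_delta opprB. Qed.

Lemma delta_skew_diag a : delta_skew a a = 0.
Proof. exact: subrr. Qed.

Lemma delta_mul_delta (a b c d : 'I_(N + N)) M :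
  delta_mx a b *m M *m delta_mx c d = M b c *: delta_mx a d.
Proof.
apply/matrixP => i j; rewrite !mxE (bigD1 c) //= big1 => [|k kc].
  rewrite !mxE eqxx (bigD1 b) //= big1 => [|k kb]; last first.
    by rewrite mxE (negPf kb) andbF mul0r.
  by rewrite !mxE eqxx andbT !addr0 /= mulrAC -natrM mulnb mulrC.
by rewrite [X in _ * X]mxE (negPf kc) mulr0.
Qed.

(** The structure constants of the orthogonal Lie algebra of [hypmx], for the bracket M h M' - M' h
    M on skew matrices. *)
Lemma delta_skew_bracket a b c d :
  delta_skew a b *m hypmx *m delta_skew c d
  - delta_skew c d *m hypmx *m delta_skew a b
  = hypmx b c *: delta_skew a d - hypmx b d *: delta_skew a c
    - hypmx a c *: delta_skew b d + hypmx a d *: delta_skew b c.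
Proof.
have hC i j : hypmx i j = hypmx j i by rewrite -[in LHS]hypmx_sym mxE.
rewrite /delta_skew !(mulmxBl, mulmxBr) !delta_mul_delta.
rewrite (hC d a) (hC c a) (hC d b) (hC c b).
move: (hypmx a c) (hypmx a d) (hypmx b c) (hypmx b d) => x1 x2 x3 x4.
by apply/matrixP => i j; rewrite !mxE; ring.
Qed.

(** The sum runs over ordered pairs, so each unordered pair counts twice; hence the factor 2^-1. *)
Lemma skew_decomp M : M^T = - M ->
  M = \sum_a \sum_b M a b *: (2^-1 *: delta_skew a b).
Proof.
move=> asM.
have -> : \sum_a \sum_b M a b *: (2^-1 *: delta_skew a b) = 2^-1 *: (M - M^T).
  have -> : M^T = \sum_a \sum_b M a b *: delta_mx b a.
    rewrite [LHS]matrix_sum_delta exchange_big /=.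
    by apply: eq_bigr => a _; apply: eq_bigr => b _; rewrite mxE.
  rewrite {2}(matrix_sum_delta M) -sumrB scaler_sumr; apply: eq_bigr => a _.
  rewrite -sumrB scaler_sumr; apply: eq_bigr => b _.
  by rewrite -scalerBr scalerA mulrC -scalerA.
by rewrite asM opprK -mulr2n -[M *+ 2]scaler_nat scalerA mulVf ?scale1r // pnatr_eq0.
Qed.
End Blocks.

(** * Operators quadratic in an orthonormal coframe *)

Section Representation.
Variables (R : realType) (s n : nat) (G : 'M[R]_n).
Variable v : 'I_2 -> 'I_s.+1 -> 'rV[R]_n.
Hypothesis unitG : G \in unitmx.
Hypothesis orthoG : orthonormal_coframe G v.

Local Notation N := s.+1.
Local Notation hypmx := (@hypmx R N).
Local Notation hypmx2 := (@hypmx2 R N).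
Local Notation delta_skew := (@delta_skew R N).
Implicit Types (M S : 'M[R]_(N + N)) (z : R[i]) (i : 'I_2) (j k l : 'I_N).

Definition fermion i (a : 'I_(N + N)) : op_alg R n :=
  match fintype.split a with
  | inl j => opE (v i j)
  | inr j => contract G (v i j)
  end.

Lemma fermion_lshift i j : fermion i (lshift N j) = opE (v i j).
Proof. by rewrite /fermion (unsplitK (inl j)). Qed.

Lemma fermion_rshift i j : fermion i (rshift N j) = contract G (v i j).
Proof. by rewrite /fermion (unsplitK (inr j)). Qed.

Lemma hypmx_ll j k : hypmx (lshift N j) (lshift N k) = 0.
Proof. by rewrite block_mxEul mxE. Qed.

Lemma hypmx_rr j k : hypmx (rshift N j) (rshift N k) = 0.
Proof. by rewrite block_mxEdr mxE. Qed.

Lemma hypmx_lr j k : hypmx (lshift N j) (rshift N k) = (j == k)%:R.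
Proof. by rewrite block_mxEur mxE. Qed.

Lemma hypmx_rl j k : hypmx (rshift N j) (lshift N k) = (j == k)%:R.
Proof. by rewrite block_mxEdl mxE. Qed.

(** The canonical anticommutation relations. Orthonormality of v enters only for a wedge operator
    against a contraction. *)
Lemma fermion_clifford i i' (a b : 'I_(N + N)) :
  fermion i a * fermion i' b + fermion i' b * fermion i a =
  ((i == i')%:R * hypmx a b)%:C%:A.
Proof.
case: (split_ordP a) => j ->; case: (split_ordP b) => k ->;
  rewrite ?(fermion_lshift, fermion_rshift);
  rewrite ?(hypmx_ll, hypmx_lr, hypmx_rl, hypmx_rr).
- by rewrite mulr0 scale0r; exact: opE_anticommute.
- by rewrite -natrM mulnb eq_sym [j == k]eq_sym -orthoG; exact: opE_contract.
- by rewrite -natrM mulnb addrC -orthoG; exact: opE_contract.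
- by rewrite mulr0 scale0r; exact: contract_anticommute.
Qed.

Definition chi (c : 'I_(N + N + (N + N))) : op_alg R n :=
  match fintype.split c with inl a => fermion ord0 a | inr a => fermion ord_max a end.

Lemma chi_lshift a : chi (lshift _ a) = fermion ord0 a.
Proof. by rewrite /chi (unsplitK (inl a)). Qed.

Lemma chi_rshift a : chi (rshift _ a) = fermion ord_max a.
Proof. by rewrite /chi (unsplitK (inr a)). Qed.

Lemma chi_clifford c d : chi c * chi d + chi d * chi c = (hypmx2 c d)%:A.
Proof.
case: (split_ordP c) => a ->; case: (split_ordP d) => b ->;
  rewrite ?(chi_lshift, chi_rshift) fermion_clifford.
- by rewrite [hypmx2 _ _]block_mxEul [map_mx _ _ _ _]mxE eqxx mul1r.
- rewrite [hypmx2 _ _]block_mxEur mul0r.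
  exact: (congr1 (fun x => x%:A) (esym (mxE _ _ _ _))).
- rewrite [hypmx2 _ _]block_mxEdl mul0r.
  exact: (congr1 (fun x => x%:A) (esym (mxE _ _ _ _))).
- by rewrite [hypmx2 _ _]block_mxEdr [map_mx _ _ _ _]mxE eqxx mul1r.
Qed.

Definition quad (B : 'M[R[i]]_(N + N + (N + N))) : op R n := bilsum chi chi B.

Lemma quad_blk z M S :
  quad (blk z M S) =
  (bilsum (fermion ord0) (fermion ord0) (map_mx (real_complex R) M)
   + z *: bilsum (fermion ord0) (fermion ord_max) (map_mx (real_complex R) S)
   + (- (z *: bilsum (fermion ord_max) (fermion ord0) (map_mx (real_complex R) S))
      + bilsum (fermion ord_max) (fermion ord_max) (map_mx (real_complex R) M))
   : op_alg R n).
Proof.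
rewrite /quad /blk bilsum_block.
have -> : (fun a => chi (lshift (N + N) a)) = fermion ord0.
  by apply/funext => a; rewrite chi_lshift.
have -> : (fun a => chi (rshift (N + N) a)) = fermion ord_max.
  by apply/funext => a; rewrite chi_rshift.
by rewrite bilsumZ -scaleN1r bilsumZ bilsumZ scaleN1r.
Qed.

Lemma quadD (B C : 'M[R[i]]_(N + N + (N + N))) : quad (B + C) = quad B + quad C.
Proof. exact: (@bilsumD _ (op_alg R n) _ _ chi chi). Qed.

Lemma quadZ z (B : 'M[R[i]]_(N + N + (N + N))) : quad (z *: B) = z *: quad B.
Proof. exact: (@bilsumZ _ (op_alg R n) _ _ chi chi). Qed.

Lemma bracket_quad (B C : 'M[R[i]]_(N + N + (N + N))) : B^T = - B -> C^T = - C ->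
  bracket (quad B) (quad C) = quad ((B *m hypmx2 *m C - C *m hypmx2 *m B) *+ 2).
Proof.
exact: (commutator_quad (hypmx2_sym _ _) chi_clifford).
Qed.

Lemma quad_inj (B : 'M[R[i]]_(N + N + (N + N))) : B^T = - B -> quad B = 0 -> B = 0.
Proof. exact: (bilsum_skew_inj (hypmx2_sym _ _) (hypmx2K _ _) chi_clifford). Qed.

(** Half the commutator of chi_(i,a) and chi_(i,b), summed over i. When these anticommute it is the
    sum of their products, which is how L_jk and Lambda_jk arise. *)
Definition lef_basis a b : op R n := quad (blk 0 (2^-1 *: delta_skew a b) 0).

Lemma scale_half (x : op R n) : (2^-1 : R)%:C *: (x + x) = x.
Proof.
rewrite scalerDr -scalerDl -rmorphD (_ : 2^-1 + 2^-1 = 1 :> R) ?scale1r //.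
by field.
Qed.

Lemma lef_basisE a b : hypmx a b = 0 ->
  lef_basis a b = \sum_(i < 2) (fermion i a \o fermion i b)%VF.
Proof.
move=> hab; have anti i : fermion i b * fermion i a = - (fermion i a * fermion i b).
  apply/eqP; rewrite -addr_eq0 addrC fermion_clifford hab mulr0.
  by rewrite (_ : 0%:C = 0) // scale0r.
rewrite /lef_basis quad_blk map_mx0 !bilsum0 !scaler0 oppr0 addr0 add0r.
rewrite map_mxZ /= map_mxB !map_delta_mx !bilsumZ !bilsumB !bilsum_delta.
rewrite !anti !opprK !scale_half.
by rewrite 2!big_ord_recl big_ord0 addr0 (_ : lift _ _ = ord_max) //; exact/val_inj.
Qed.

Lemma quad_blk_delta z a : hypmx a a = 0 ->
  quad (blk z 0 (2^-1 *: delta_mx a a)) = z *: (fermion ord0 a \o fermion ord_max a)%VF.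
Proof.
move=> haa.
have anti : fermion ord_max a * fermion ord0 a =
    - (fermion ord0 a * fermion ord_max a).
  apply/eqP; rewrite -addr_eq0 addrC fermion_clifford haa mulr0.
  by rewrite (_ : 0%:C = 0) // scale0r.
rewrite quad_blk map_mx0 !bilsum0 addr0 add0r.
rewrite map_mxZ /= !map_delta_mx !bilsumZ !bilsum_delta anti !scalerN opprK.
rewrite -scalerDr; congr (_ *: _); rewrite -scalerDr; exact: scale_half.
Qed.

Lemma opL_quad j k : opL v j k = lef_basis (lshift N j) (lshift N k).
Proof.
rewrite lef_basisE ?hypmx_ll //.
by apply: eq_bigr => i _; rewrite !fermion_lshift.
Qed.

(** Taking adjoints reverses the two factors, hence the order k, j. *)
Lemma opLambda_quad j k : opLambda G v j k = lef_basis (rshift N k) (rshift N j).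
Proof.
rewrite lef_basisE ?hypmx_rr //; apply: (ext_adjointE unitG).
apply: adjoint_pair_sum => i; rewrite !fermion_rshift.
by apply: adjoint_pair_comp; exact: adjoint_pair_opE.
Qed.

Lemma opV_quad z j :
  z *: opV v j = quad (blk z 0 (2^-1 *: delta_mx (lshift N j) (lshift N j))).
Proof.
rewrite (quad_blk_delta z (hypmx_ll j j)); apply: (congr1 ( *:%R z)).
by rewrite /opV !fermion_lshift.
Qed.

(** The adjoint reverses the two factors of V_j; restoring their order costs the minus sign, as
    contractions anticommute. *)
Lemma opA_quad z j :
  z *: opA G v j = quad (blk z 0 (- (2^-1 *: delta_mx (rshift N j) (rshift N j)))).
Proof.
have -> : opA G v j = (contract G (v ord_max j) \o contract G (v ord0 j))%VF.
  apply: (ext_adjointE unitG).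
  by apply: adjoint_pair_comp; exact: adjoint_pair_opE.
rewrite -[X in blk z X]oppr0 -blkN -scaleN1r quadZ quad_blk_delta ?hypmx_rr //.
rewrite !fermion_rshift scaleN1r -scalerN; congr (_ *: _).
by apply/eqP; rewrite -addr_eq0; apply/eqP; exact: contract_anticommute.
Qed.

Definition quad_set z : set (op R n) :=
  [set A | exists M S, [/\ M^T = - M, S^T = S & A = quad (blk z M S)]].

Lemma lef_basis_quad_set z a b : quad_set z (lef_basis a b).
Proof.
exists (2^-1 *: delta_skew a b), 0; rewrite blk0 trmx0; split=> //.
by rewrite linearZ /= delta_skew_tr scalerN.
Qed.

(* The bracket of two off-diagonal parts z S and z S' involves z only through its
   square: this is why z = 0, 1, 'i give real Lie algebras. *)
Lemma quad_set_lie z (r : R) (gens : set (op R n)) : z * z = r%:C ->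
  gens `<=` quad_set z -> real_lie_gen gens `<=` quad_set z.
Proof.
move=> zz sub A; elim=> {A} [A /sub//||A B _ [M [S [asM sS ->]]] _ [M' [S' [asM' sS' ->]]]
  |c A _ [M [S [asM sS ->]]]|A B _ [M [S [asM sS ->]]] _ [M' [S' [asM' sS' ->]]]].
- exists 0, 0; rewrite !trmx0 oppr0; split=> //.
  by rewrite quad_blk map_mx0 !bilsum0 !scaler0 oppr0 !addr0.
- exists (M + M'), (S + S'); rewrite -blkD quadD !linearD /= asM asM' sS sS'.
  by split.
- by exists (c *: M), (c *: S); rewrite -blkZ quadZ !linearZ /= asM sS scalerN.
- have tD (X Y : 'M[R]_(N + N)) : (X + Y)^T = X^T + Y^T by rewrite linearD.
  have tN (X : 'M[R]_(N + N)) : (- X)^T = - X^T by rewrite linearN.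
  have tZ c (X : 'M[R]_(N + N)) : (c *: X)^T = c *: X^T by rewrite linearZ.
  rewrite bracket_quad ?blk_skew // !(blkM _ _ _ _ zz) blkN blkD.
  rewrite mulr2n blkD -mulr2n -mulr2n.
  eexists _, _; split; last by [].
    rewrite linearMn /= -mulNrn; congr (_ *+ 2).
    rewrite !(tD, tN, tZ) !trmx_mul asM asM' sS sS' hypmx_sym.
    by rewrite !(mulmxN, mulNmx) !opprK !mulmxA [in RHS]opprB.
  rewrite linearMn /=; congr (_ *+ 2).
  rewrite !(tD, tN, tZ) !trmx_mul asM asM' sS sS' hypmx_sym.
  rewrite !(mulmxN, mulNmx) !mulmxA.
  move: (S' *m _ *m _) (M' *m _ *m _) (S *m _ *m _) (M *m _ *m _) => W Y Z X.
  by rewrite -[- W - Y]opprD -[- Z - X]opprD opprK addrC [Z + X]addrC [W + Y]addrC.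
Qed.

End Representation.

(** * The three Lie algebras *)

(** Here s >= 2 enters: there are at least three indices. *)
Lemma ord_avoid2 s (j k : 'I_s.+1) : (2 <= s)%N -> exists l, l != j /\ l != k.
Proof.
move=> s2; have : (0 < #|~: [set j; k]|)%N.
  rewrite cardsCs finset.setCK card_ord subn_gt0 cards2.
  by case: (j != k) => //; exact: leq_trans s2 _.
by case/card_gt0P => l; rewrite !inE negb_or => /andP[]; exists l.
Qed.

Lemma lie_opp (R : realType) n (gens : set (op R n)) A :
  real_lie_gen gens A -> real_lie_gen gens (- A).
Proof. by move=> LA; rewrite -scaleN1r -(rmorphN1 (real_complex R)); exact: lie_scale. Qed.

Lemma lie_sum (R : realType) n (gens : set (op R n)) (I : finType) (F : I -> op R n) :
  (forall i, real_lie_gen gens (F i)) -> real_lie_gen gens (\sum_i F i).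
Proof.
move=> LF; apply: (big_ind (real_lie_gen gens)) => //; first exact: lie_zero.
by move=> A B; exact: lie_add.
Qed.

Lemma lie_mono (R : realType) n (gens gens' : set (op R n)) :
  gens `<=` gens' -> real_lie_gen gens `<=` real_lie_gen gens'.
Proof.
move=> sub A; elim=> {A} [A /sub|||c A _|A B _ LA _].
- exact: lie_gen.
- exact: lie_zero.
- by move=> A B _ LA _; exact: lie_add.
- exact: lie_scale.
- exact: lie_bracket.
Qed.

Lemma real_scale0 (R : realType) n (A : op R n) : (0 : R)%:C *: A = 0.
Proof. exact: scale0r. Qed.

Lemma real_scale1 (R : realType) n (A : op R n) : (1 : R)%:C *: A = A.
Proof. exact: scale1r. Qed.

Lemma scale_one_zero_zero (R : realType) n (t1 t2 t3 t : R) (X Y Z W : op R n) :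
  t1 = 1 -> t2 = 0 -> t3 = 0 ->
  t1%:C *: X - t2%:C *: Y - t3%:C *: Z + t%:C *: W = X + t%:C *: W.
Proof.
move=> t1E t2E t3E.
have -> : t1%:C *: X = X by rewrite t1E real_scale1.
have -> : t2%:C *: Y = 0 by rewrite t2E real_scale0.
have -> : t3%:C *: Z = 0 by rewrite t3E real_scale0.
by rewrite !subr0.
Qed.

(** * Generation of [Lef] and its description inside [LR] and [sL] *)

Section Lefschetz.
Variables (R : realType) (s n : nat) (G : 'M[R]_n).
Variable v : 'I_2 -> 'I_s.+1 -> 'rV[R]_n.
Hypothesis unitG : G \in unitmx.
Hypothesis orthoG : orthonormal_coframe G v.
Hypothesis s2 : (2 <= s)%N.

Local Notation N := s.+1.
Local Notation hypmx := (@hypmx R N).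
Local Notation delta_skew := (@delta_skew R N).
Local Notation quad := (quad G v).
Local Notation lef_basis := (lef_basis G v).
Implicit Types (M S : 'M[R]_(N + N)) (z : R[i]) (i : 'I_2) (j k l : 'I_N).

(** The block diagonal case, in which M acts alike on both copies i = 1, 2. On real skew matrices it
    parametrises [Lef], see [LefP]. *)
Definition lef_op M : op R n := quad (blk 0 M 0).

Lemma lef_opD M M' : lef_op (M + M') = lef_op M + lef_op M'.
Proof. by rewrite /lef_op -quadD blkD addr0. Qed.

Lemma lef_opZ c M : lef_op (c *: M) = c%:C *: lef_op M.
Proof. by rewrite /lef_op -quadZ blkZ scaler0. Qed.

Lemma lef_opN M : lef_op (- M) = - lef_op M.
Proof. by rewrite -scaleN1r lef_opZ rmorphN1 scaleN1r. Qed.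

Lemma lef_op0 : lef_op 0 = 0.
Proof. by rewrite -(scale0r 0) lef_opZ scale0r. Qed.

Lemma lef_op_sum (I : finType) (F : I -> 'M[R]_(N + N)) :
  lef_op (\sum_i F i) = \sum_i lef_op (F i).
Proof. exact: (big_morph lef_op lef_opD lef_op0). Qed.

Lemma bracket_lef_op M M' : M^T = - M -> M'^T = - M' ->
  bracket (lef_op M) (lef_op M') =
  lef_op ((M *m hypmx *m M' - M' *m hypmx *m M) *+ 2).
Proof.
move=> asM asM'; rewrite /lef_op.
have s0 : (0 : 'M[R]_(N + N))^T = 0 by rewrite trmx0.
rewrite (bracket_quad unitG orthoG (blk_skew 0 asM s0) (blk_skew 0 asM' s0)).
have zz : (0 : R[i]) * 0 = (0 : R)%:C by rewrite mul0r.
rewrite !(blkM _ _ _ _ zz) !scale0r !subr0 !(mulmx0, mul0mx) !addr0.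
by rewrite blkN blkD oppr0 addr0 mulr2n blkD addr0 -mulr2n.
Qed.

Lemma lef_basis_op a b : lef_basis a b = lef_op (2^-1 *: delta_skew a b).
Proof. by []. Qed.

Lemma lef_basisN a b : lef_basis b a = - lef_basis a b.
Proof.
by rewrite !lef_basis_op -lef_opN -scalerN opprB.
Qed.

Lemma bracket_lef_basis a b c d :
  bracket (lef_basis a b) (lef_basis c d) =
  (hypmx b c)%:C *: lef_basis a d - (hypmx b d)%:C *: lef_basis a c
  - (hypmx a c)%:C *: lef_basis b d + (hypmx a d)%:C *: lef_basis b c.
Proof.
have half_tr x y : (2^-1 *: delta_skew x y)^T = - (2^-1 *: delta_skew x y).
  by rewrite linearZ /= delta_skew_tr scalerN.
rewrite !lef_basis_op (bracket_lef_op (half_tr _ _) (half_tr _ _)).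
rewrite -!scalemxAl -!scalemxAr -!scalerBr delta_skew_bracket.
have comb x1 x2 x3 x4 M1 M2 M3 M4 :
    x1%:C *: lef_op M1 - x2%:C *: lef_op M2 - x3%:C *: lef_op M3 + x4%:C *: lef_op M4
    = lef_op (x1 *: M1 - x2 *: M2 - x3 *: M3 + x4 *: M4).
  by rewrite 3!lef_opD 2!lef_opN 4!lef_opZ.
rewrite comb; apply: (congr1 lef_op).
move: (delta_skew a d) (delta_skew a c) (delta_skew b d) (delta_skew b c) => y1 y2 y3 y4.
move: (hypmx a c) (hypmx a d) (hypmx b c) (hypmx b d) => x1 x2 x3 x4.
by apply/matrixP => i j; rewrite !mxE; field.
Qed.

Lemma Lef_basis_ll j k : Lef G v (lef_basis (lshift N j) (lshift N k)).
Proof.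
have [->|jk] := eqVneq j k.
  by rewrite lef_basis_op delta_skew_diag scaler0 lef_op0; exact: lie_zero.
by rewrite -(opL_quad unitG orthoG); apply: lie_gen; exists j, k; split=> //; left.
Qed.

Lemma Lef_basis_rr j k : Lef G v (lef_basis (rshift N j) (rshift N k)).
Proof.
have [->|jk] := eqVneq j k.
  by rewrite lef_basis_op delta_skew_diag scaler0 lef_op0; exact: lie_zero.
rewrite -(opLambda_quad unitG orthoG); apply: lie_gen; exists k, j.
by split; [rewrite eq_sym|right].
Qed.

(* As j = k only yields the sum of two elements, the case j = k of [Lef_basis_lr]
   needs three distinct indices. *)
Lemma Lef_basis_lr_add j k l : l != j -> l != k ->
  Lef G v (lef_basis (lshift N j) (rshift N k)
           + ((j == k)%:R : R)%:C *: lef_basis (lshift N l) (rshift N l)).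
Proof.
move=> lj lk.
have E := bracket_lef_basis (lshift N j) (lshift N l) (rshift N l) (rshift N k).
rewrite !hypmx_lr in E.
have -> : lef_basis (lshift N j) (rshift N k)
    + ((j == k)%:R : R)%:C *: lef_basis (lshift N l) (rshift N l)
    = bracket (lef_basis (lshift N j) (lshift N l))
        (lef_basis (rshift N l) (rshift N k)).
  rewrite E; apply/esym/scale_one_zero_zero; rewrite ?eqxx ?(negPf lk) //.
  by rewrite eq_sym (negPf lj).
by apply: lie_bracket; [exact: Lef_basis_ll|exact: Lef_basis_rr].
Qed.

Lemma Lef_basis_lr j k : Lef G v (lef_basis (lshift N j) (rshift N k)).
Proof.
have [l [lj lk]] := ord_avoid2 j k s2.
have [jk|jk] := eqVneq j k; last first.
  by have := Lef_basis_lr_add lj lk; rewrite (negPf jk) mulr0n real_scale0 addr0.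
rewrite -{}jk in lk *.
have [m [mj ml]] := ord_avoid2 j l s2.
have P x y : y != x -> Lef G v (lef_basis (lshift N x) (rshift N x)
    + lef_basis (lshift N y) (rshift N y)).
  by move=> yx; have := Lef_basis_lr_add yx yx; rewrite eqxx mulr1n real_scale1.
have := P _ _ lj; have := P _ _ mj; have := P _ _ ml.
move: (lef_basis (lshift N j) _) (lef_basis (lshift N l) _)
  (lef_basis (lshift N m) _) => x y z Pyz Pxz Pxy.
(* Only the pairwise sums of the elements x, y, z for j, l, m are available; 2 x is (x + z) + (x +
   y) - (y + z). *)
rewrite -[x](scale_half x); apply: lie_scale.
have -> : x + x = x + z + (x + y) - (y + z).
  by rewrite [y + z]addrC addrACA addrK.
by apply: lie_add; [exact: lie_add|exact: lie_opp].
Qed.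

(** By [skew_decomp] it suffices to reach every [lef_basis] element. Those within one half of the
    indices are generators or zero, and the mixed ones come from brackets of an L with a Lambda. *)
Lemma Lef_lef_op M : M^T = - M -> Lef G v (lef_op M).
Proof.
move=> asM; rewrite (skew_decomp asM) lef_op_sum; apply: lie_sum => a.
rewrite lef_op_sum; apply: lie_sum => b; rewrite lef_opZ; apply: lie_scale.
case: (split_ordP a) => j ->; case: (split_ordP b) => k ->.
- exact: Lef_basis_ll.
- exact: Lef_basis_lr.
- rewrite -lef_basis_op lef_basisN; apply: lie_opp; exact: Lef_basis_lr.
- exact: Lef_basis_rr.
Qed.

(** The direct inclusion is [quad_set_lie] at z = 0, where the off-diagonal blocks disappear. *)
Lemma LefP A : Lef G v A <-> exists2 M, M^T = - M & A = lef_op M.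
Proof.
split=> [|[M asM ->]]; last exact: Lef_lef_op.
have zz : (0 : R[i]) * 0 = (0 : R)%:C by rewrite mul0r.
suff H : Lef G v `<=` quad_set G v 0.
  move=> /H[M [S [asM _ ->]]]; exists M; first exact: asM.
  exact: (congr1 quad (blk_real M S)).
apply: (quad_set_lie unitG orthoG zz) => _ [j [k [_ [|] ->]]].
  by rewrite (opL_quad unitG orthoG); exact: lef_basis_quad_set.
by rewrite (opLambda_quad unitG orthoG); exact: lef_basis_quad_set.
Qed.

Lemma half_delta_sym (a : 'I_(N + N)) :
  (2^-1 *: delta_mx a a : 'M[R]_(N + N))^T = 2^-1 *: delta_mx a a.
Proof. by rewrite linearZ /= trmx_delta. Qed.

Lemma LR_sub : LR G v `<=` quad_set G v 1.
Proof.
apply: (@quad_set_lie _ _ _ _ _ unitG orthoG 1 1); first by rewrite mul1r.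
move=> _ [[j [k [_ [|] ->]]]|[j [|] ->]].
- by rewrite (opL_quad unitG orthoG); exact: lef_basis_quad_set.
- by rewrite (opLambda_quad unitG orthoG); exact: lef_basis_quad_set.
- rewrite -[opV v j]scale1r (opV_quad unitG orthoG).
  exists 0, (2^-1 *: delta_mx (lshift N j) (lshift N j)).
  by rewrite trmx0 oppr0 half_delta_sym.
rewrite -[opA G v j]scale1r (opA_quad unitG orthoG).
exists 0, (- (2^-1 *: delta_mx (rshift N j) (rshift N j))); rewrite trmx0 oppr0.
by split=> //; rewrite linearN /= half_delta_sym.
Qed.

Lemma sL_sub : sL G v `<=` quad_set G v 'i.
Proof.
apply: (@quad_set_lie _ _ _ _ _ unitG orthoG 'i (- 1)).
  by rewrite -expr2 sqrCi rmorphN1.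
move=> _ [[j [k [_ [|] ->]]]|[j [|] ->]].
- by rewrite (opL_quad unitG orthoG); exact: lef_basis_quad_set.
- by rewrite (opLambda_quad unitG orthoG); exact: lef_basis_quad_set.
- rewrite (opV_quad unitG orthoG).
  exists 0, (2^-1 *: delta_mx (lshift N j) (lshift N j)).
  by rewrite trmx0 oppr0 half_delta_sym.
rewrite (opA_quad unitG orthoG).
exists 0, (- (2^-1 *: delta_mx (rshift N j) (rshift N j))); rewrite trmx0 oppr0.
by split=> //; rewrite linearN /= half_delta_sym.
Qed.

Lemma quad_eq (B C : 'M[R[i]]_(N + N + (N + N))) : B^T = - B -> C^T = - C ->
  quad B = quad C -> B = C.
Proof.
move=> asB asC BC; apply/eqP; rewrite -subr_eq0; apply/eqP.
apply: (quad_inj unitG orthoG).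
  by rewrite linearB /= asB asC opprB opprK addrC.
by rewrite -scaleN1r quadD quadZ scaleN1r BC subrr.
Qed.

(** A common element of [LR] and [sL] has two presentations, with z = 1 and z = 'i. Injectivity of
    [quad] on skew matrices equates them, so S = 'i S' with S and S' real, and only the block
    diagonal part remains. *)
Lemma Lef_eq : Lef G v = LR G v `&` sL G v.
Proof.
apply/seteqP; split=> [A LA|A [/LR_sub[M [S [asM sS ->]]] /sL_sub[M' [S' [asM' sS' E]]]]].
  by split; apply: lie_mono LA => B; left.
have := quad_eq (blk_skew 1 asM sS) (blk_skew 'i asM' sS') E.
case/eq_block_mx => _ SS' _ _.
suff S0 : S = 0 by rewrite S0 blk0; exact: Lef_lef_op.
apply/matrixP => a b; have := congr1 (fun X : 'M[R[i]]_(N + N) => X a b) SS'.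
rewrite !mxE mul1r => Eab.
(* Conjugation fixes the real entry S a b and negates 'i times the entry of S', so S a b equals its
   own opposite. *)
have /eqP := congr1 Num.conj Eab; rewrite rmorphM /= conjCi !conj_real_complex mulNr -Eab.
by rewrite -addr_eq0 -mulr2n mulrn_eq0 /= fmorph_eq0 => /eqP.
Qed.

End Lefschetz.

(** * The isomorphism with so(s+1,s+1) *)

Section Diagonalisation.
Variables (R : realType) (N : nat).
Local Notation hypmx := (@hypmx R N).
Implicit Types M Y : 'M[R]_(N + N).

Definition so_form : 'M[R]_(N + N) := block_mx 1%:M 0 0 (- 1%:M).
Definition hadamard : 'M[R]_(N + N) := block_mx 1%:M 1%:M 1%:M (- 1%:M).
(** Write P for [hadamard], h for [hypmx] and eta for [so_form]. As h P = P eta and P has inverse P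
    / 2, this is the conjugate by P of 2 M h, the matrix by which [lef_op M] acts on the chi. *)
Definition to_so M := hadamard *m M *m hadamard *m so_form.
Definition of_so Y := 4^-1 *: (hadamard *m Y *m so_form *m hadamard).

Lemma so_form_sym : so_form^T = so_form.
Proof. by rewrite tr_block_mx linearN /= !trmx0 trmx1. Qed.

Lemma hadamard_sym : hadamard^T = hadamard.
Proof. by rewrite tr_block_mx linearN /= !trmx1. Qed.

Lemma so_formK : so_form *m so_form = 1%:M.
Proof.
rewrite mulmx_block !mulmx0 !mul0mx mulmxN mulNmx opprK !mulmx1 !addr0 !add0r.
by rewrite -scalar_mx_block.
Qed.

Lemma hadamardK : hadamard *m hadamard = 2%:M.
Proof.
rewrite mulmx_block !mulmxN !mulNmx opprK !mulmx1 subrr -!raddfD /=.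
by rewrite -scalar_mx_block.
Qed.

Lemma hypmx_hadamard : hypmx *m hadamard = hadamard *m so_form.
Proof.
rewrite !mulmx_block !mulmxN !mulNmx opprK !mulmx0 !mul0mx !mulmx1 !addr0 !add0r.
by rewrite !subr0.
Qed.

Lemma to_soD M M' : to_so (M + M') = to_so M + to_so M'.
Proof. by rewrite /to_so mulmxDr !mulmxDl. Qed.

Lemma to_soZ c M : to_so (c *: M) = c *: to_so M.
Proof. by rewrite /to_so -scalemxAr -!scalemxAl. Qed.

Lemma to_soN M : to_so (- M) = - to_so M.
Proof. by rewrite -scaleN1r to_soZ scaleN1r. Qed.

(** Replacing P eta by h P between the two factors leaves P P = 2, so the twisted product 2 M h M'
    becomes the matrix product. *)
Lemma to_soM M M' : to_so M *m to_so M' = to_so ((M *m hypmx *m M') *+ 2).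
Proof.
have -> : to_so M *m to_so M' =
    hadamard *m M *m hypmx *m (hadamard *m hadamard) *m M' *m hadamard *m so_form.
  rewrite /to_so -[hadamard *m M *m hadamard *m so_form]mulmxA -hypmx_hadamard.
  by rewrite !mulmxA.
rewrite hadamardK mul_mx_scalar -!scalemxAl.
by rewrite -[_ *m M' *+ 2]scaler_nat to_soZ /to_so !mulmxA.
Qed.

Lemma to_soK : cancel to_so of_so.
Proof.
move=> M; rewrite /of_so /to_so !mulmxA hadamardK mul_scalar_mx.
rewrite -!scalemxAl -[_ *m so_form *m so_form]mulmxA so_formK mulmx1.
rewrite -[_ *m hadamard *m hadamard]mulmxA hadamardK.
rewrite mul_mx_scalar !scalerA (_ : _ * _ = 1) ?scale1r //.
by field.
Qed.

Lemma of_soK : cancel of_so to_so.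
Proof.
move=> Y; rewrite /of_so /to_so -scalemxAr !mulmxA hadamardK mul_scalar_mx.
rewrite -!scalemxAl -[_ *m hadamard *m hadamard]mulmxA hadamardK mul_mx_scalar -!scalemxAl.
rewrite -[_ *m so_form *m so_form]mulmxA so_formK mulmx1 !scalerA.
rewrite (_ : _ * _ = 1) ?scale1r //.
by field.
Qed.

Lemma soE Y : @so R N N Y <-> Y^T *m so_form + so_form *m Y = 0.
Proof. by []. Qed.

Lemma to_so_in M : M^T = - M -> @so R N N (to_so M).
Proof.
move=> asM; apply/soE; rewrite /to_so !trmx_mul so_form_sym hadamard_sym asM.
by rewrite !(mulmxN, mulNmx) !mulmxA addNr.
Qed.

Lemma of_so_skew Y : @so R N N Y -> (of_so Y)^T = - of_so Y.
Proof.
(* Multiplying the defining equation by [so_form] on both sides shows that Y *m so_form is skew. *)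
move=> /soE YY; have E : so_form *m Y^T = - (Y *m so_form).
  apply/eqP; rewrite -addr_eq0; apply/eqP.
  have := congr1 (fun X => so_form *m X *m so_form) YY.
  rewrite mulmxDr mulmxDl mulmx0 mul0mx !mulmxA so_formK mul1mx.
  by rewrite -[_ *m so_form *m so_form]mulmxA so_formK mulmx1.
rewrite /of_so linearZ /= -scalerN; congr (_ *: _).
rewrite !trmx_mul so_form_sym hadamard_sym [so_form *m _]mulmxA E.
by rewrite !(mulmxN, mulNmx) !mulmxA.
Qed.
End Diagonalisation.

(** * Lie algebras parametrised by skew matrices *)

Section SkewParametrisation.
Variables (R : realType) (n N : nat) (g : set (op R n)).
Variable F : 'M[R]_(N + N) -> op R n.
Implicit Types M : 'M[R]_(N + N).
Hypothesis FD : forall M M', F (M + M') = F M + F M'.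
Hypothesis FZ : forall (r : R) M, F (r *: M) = r%:C *: F M.
Hypothesis F_bracket : forall M M', M^T = - M -> M'^T = - M' ->
  bracket (F M) (F M') = F ((M *m hypmx R N *m M' - M' *m hypmx R N *m M) *+ 2).
Hypothesis F_inj : forall M M', M^T = - M -> M'^T = - M' -> F M = F M' -> M = M'.
Hypothesis gP : forall A, g A <-> exists2 M, M^T = - M & A = F M.

(** The inverse of F is taken by choice, because an isomorphism must be a function on all operators;
    outside g it takes the irrelevant value [to_so 0]. *)
Definition so_of (A : op R n) : 'M[R]_(N + N) :=
  to_so (xget 0 [set M | M^T = - M /\ A = F M]).

Lemma so_ofE M : M^T = - M -> so_of (F M) = to_so M.
Proof.
move=> asM; congr to_so; apply: xget_unique; first by split.
by move=> M' [asM' E]; exact: F_inj.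
Qed.

Lemma real_lie_iso_so : real_lie_iso g (@so R N N).
Proof.
exists so_of; split.
- split=> [_ /gP[M asM ->]|_ _ /set_mem/gP[M asM ->] /set_mem/gP[M' asM' ->]|Y soY].
  + by rewrite so_ofE //; exact: to_so_in.
  + by rewrite !so_ofE // => /(can_inj (@to_soK _ _)) ->.
  + exists (F (of_so Y)); first by apply/gP; exists (of_so Y) => //; exact: of_so_skew.
    by rewrite so_ofE ?of_soK //; exact: of_so_skew.
- move=> _ _ /gP[M asM ->] /gP[M' asM' ->].
  by rewrite -FD !so_ofE ?to_soD // linearD /= asM asM' opprD.
- move=> r _ /gP[M asM ->].
  by rewrite -FZ !so_ofE ?to_soZ // linearZ /= asM scalerN.
- move=> _ _ /gP[M asM ->] /gP[M' asM' ->].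
  rewrite F_bracket // !so_ofE // ?to_soM.
    by rewrite -to_soN -to_soD -mulNrn -mulrnDl.
  (* It remains to see that the matrix of the bracket is again skew, as [so_ofE] requires. *)
  rewrite linearMn /= -mulNrn; congr (_ *+ 2).
  rewrite [LHS]linearB /= !trmx_mul asM asM' hypmx_sym.
  by rewrite !(mulmxN, mulNmx) !opprK !mulmxA opprB.
Qed.

End SkewParametrisation.

Section Isomorphism.
Variables (R : realType) (s n : nat) (G : 'M[R]_n).
Variable v : 'I_2 -> 'I_s.+1 -> 'rV[R]_n.
Hypothesis unitG : G \in unitmx.
Hypothesis orthoG : orthonormal_coframe G v.
Hypothesis s2 : (2 <= s)%N.

Local Notation N := s.+1.
Local Notation lef_op := (lef_op G v).
Implicit Types M : 'M[R]_(N + N).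

Lemma lef_op_inj M M' : M^T = - M -> M'^T = - M' -> lef_op M = lef_op M' -> M = M'.
Proof.
have s0 : (0 : 'M[R]_(N + N))^T = 0 by rewrite trmx0.
move=> asM asM' /(quad_eq unitG orthoG (blk_skew 0 asM s0) (blk_skew 0 asM' s0)).
case/eq_block_mx => E _ _ _; apply/matrixP => a b.
by have := congr1 (fun X : 'M[R[i]]_(N + N) => X a b) E; rewrite !mxE => /complexI.
Qed.

Lemma Lef_iso : real_lie_iso (Lef G v) (@so R N N).
Proof.
exact: (real_lie_iso_so (lef_opD G v) (lef_opZ G v) (bracket_lef_op unitG orthoG)
  lef_op_inj (LefP unitG orthoG s2)).
Qed.

End Isomorphism.

(** * Invertibility of the metric and conclusion at a point *)

(** The 2 (s + 1) covectors are the rows of a square matrix V, and orthonormality reads V *m invmx G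
    *m V^T = 1; so [invmx G], and with it G, is invertible. *)
Lemma orthonormal_coframe_unitmx (R : realType) s (G : 'M[R]_(2 * s.+1))
    (v : 'I_2 -> 'I_s.+1 -> 'rV[R]_(2 * s.+1)) :
  orthonormal_coframe G v -> G \in unitmx.
Proof.
move=> orthoG; rewrite -unitmx_inv.
pose V : 'M[R]_(2 * s.+1) := \matrix_(r, c) mxvec (\matrix_(i, j) v i j 0 c) 0 r.
have rowV i j : row (mxvec_index i j) V = v i j.
  by apply/rowP => c; rewrite !mxE mxvecE mxE.
suff E : V *m (invmx G *m V^T) = 1%:M.
  have [_] := mulmx1_unit E; by rewrite unitmx_mul => /andP[].
apply/row_matrixP => r; case/mxvec_indexP: r => i j.
apply/rowP => c; case/mxvec_indexP: c => k l.
have -> : row (mxvec_index i j) (V *m (invmx G *m V^T)) 0 (mxvec_index k l)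
    = cometric G (v i j) (v k l).
  by rewrite /cometric -!rowV row_mul mulmxA tr_row !mxE; apply: eq_bigr => x _;
    rewrite !mxE.
rewrite orthoG !mxE; have := mxvecE (delta_mx i j : 'M[R]__) k l.
by rewrite mxvec_delta !mxE eqxx /= eq_sym => ->; rewrite [i == k]eq_sym [j == l]eq_sym.
Qed.

(* The cotangent space at p is identified with the row vectors by an arbitrary
   chart c around p; the adapted coframe v fixes the common sign of the V_j. *)
Theorem corollary7p9 (R : realType) (s : nat) (hs : (2 <= s)%N)
    (X : manifold R (2 * s.+1)) (K : almost_skahler X) (p : X)
    (c : chart R (2 * s.+1) X) (hc : atlas c) (hp : dom c p)
    (v : 'I_2 -> 'I_s.+1 -> 'rV[R]_(2 * s.+1)) (hv : adapted_coframe K c p v) :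
  real_lie_iso (Lef (metric K c p) v) (@so R s.+1 s.+1) /\
  Lef (metric K c p) v = LR (metric K c p) v `&` sL (metric K c p) v.
Proof.
have [orthoG _] := hv; have unitG := orthonormal_coframe_unitmx orthoG.
by split; [exact: Lef_iso|exact: Lef_eq].
Qed.
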